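(* Let $K$ be an infinite compact subset of $\mathbb R^d$. Then a typical $\mu\in\mathcal P(K)$ satisfies $\underline D_\mu(+\infty)=0$, $\overline D_\mu(+\infty)=\overline{\dim}_{B,{\rm loc},{\rm unif}}(K)$, $\underline D_\mu(-\infty)=\underline{\dim}_B(K)$ and $\overline D_\mu(-\infty)=+\infty$.
   Context: $\mathcal P(K)$ is the set of Borel probability measures on $K$ with the weak topology; ''typical'' means holding on a set containing a dense $G_\delta$ subset. $B(x,r)$ is the open ball. For $\mu\in\mathcal P(K)$: $\overline D_\mu(-\infty)=\limsup_{r\to0}\frac{\log\inf_{x\in\operatorname{supp}\mu}\mu(B(x,r))}{\log r}$, $\underline D_\mu(-\infty)$ the same with $\liminf$; $\overline D_\mu(+\infty)=\limsup_{r\to0}\frac{\log\sup_{x\in\operatorname{supp}\mu}\mu(B(x,r))}{\log r}$, $\underline D_\mu(+\infty)$ the same with $\liminf$. $\mathbf N_r(E)$ is the smallest number of balls of radius $r$ covering $E$; $\overline{\dim}_{B,{\rm loc},{\rm unif}}(K)=\inf_{N\ge1}\inf_{x_1,\dots,x_N\in K}\inf_{r_0>0}\limsup_{r\to0}\min_{1\le i\le N}\frac{\log\mathbf N_r(K\cap B(x_i,r_0))}{-\log r}$. $\underline{\dim}_B$ is the lower box dimension. *)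

(* Defs.v *)
(* R^d is modelled as 'rV[R]_d (row vectors) for an
   abstract R : realType, with its (product = Euclidean) topology; balls are
   taken for the Euclidean distance, defined explicitly below. *)
From mathcomp Require Import all_boot all_algebra.
From mathcomp Require Import all_classical all_reals all_analysis.
Import numFieldNormedType.Exports.
Set Implicit Arguments. Unset Strict Implicit. Unset Printing Implicit Defensive.
Import GRing.Theory Num.Theory.
Local Open Scope classical_set_scope.
Local Open Scope ring_scope.

Notation BorelRd R d := (g_sigma_algebraType (@open 'rV[R]_d)) (only parsing).

Section Defs.
Variables (R : realType) (d : nat).
Implicit Types (x y : 'rV[R]_d) (r : R) (E K : set 'rV[R]_d).

Definition edist x y : R := Num.sqrt (\sum_(i < d) (x ord0 i - y ord0 i) ^+ 2).
Definition eball x r : set 'rV[R]_d := [set y | edist x y < r].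

Definition elog (v : \bar R) : \bar R :=
  match v with
  | EFin r => if 0 < r then (ln r)%:E else -oo%E
  | EPInf => +oo%E
  | ENInf => -oo%E
  end.

Definition elimsup0 (phi : R -> \bar R) : \bar R :=
  ereal_inf [set ereal_sup [set phi r | r in [set r | 0 < r < delta]]
            | delta in [set delta : R | 0 < delta]].
Definition eliminf0 (phi : R -> \bar R) : \bar R :=
  ereal_sup [set ereal_inf [set phi r | r in [set r | 0 < r < delta]]
            | delta in [set delta : R | 0 < delta]].

Local Notation PR := (probability (BorelRd R d) R).

Definition supp (mu : PR) : set 'rV[R]_d :=
  [set x | forall r, 0 < r -> (0 < mu (eball x r))%E].

Definition ratio_minus (mu : PR) (r : R) : \bar R :=
  (elog (ereal_inf [set mu (eball x r) | x in supp mu]) * ((ln r)^-1)%:E)%E.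
Definition ratio_plus (mu : PR) (r : R) : \bar R :=
  (elog (ereal_sup [set mu (eball x r) | x in supp mu]) * ((ln r)^-1)%:E)%E.

Definition Dup_minus (mu : PR) := elimsup0 (ratio_minus mu).
Definition Dlow_minus (mu : PR) := eliminf0 (ratio_minus mu).
Definition Dup_plus (mu : PR) := elimsup0 (ratio_plus mu).
Definition Dlow_plus (mu : PR) := eliminf0 (ratio_plus mu).

(* N_r(E): smallest number of (open Euclidean) balls of radius r covering E
   (+oo if there is no finite cover). *)
Definition Ncov E r : \bar R :=
  ereal_inf [set (n%:R)%:E | n in [set n : nat | exists c : 'I_n -> 'rV[R]_d,
                 E `<=` \bigcup_(i in [set: 'I_n]) eball (c i) r]].

Definition box_ratio E r : \bar R := (elog (Ncov E r) * ((- ln r)^-1)%:E)%E.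

Definition lower_box_dim K : \bar R := eliminf0 (box_ratio K).

Definition upper_box_dim_loc_unif K : \bar R :=
  ereal_inf [set v | exists (N : nat) (xs : 'I_N -> 'rV[R]_d) (r0 : R),
     [/\ (0 < N)%N, (forall i, K (xs i)), 0 < r0 &
       v = elimsup0 (fun r => ereal_inf [set box_ratio (K `&` eball (xs i) r0) r
                                         | i in [set: 'I_N]])]].

Definition PK K : set PR := [set mu | mu K = 1%E].

Definition weak_nbhd K (mu : PR) (n : nat) (f : 'I_n -> 'rV[R]_d -> R) (eps : R)
  : set PR :=
  [set nu | PK K nu /\ forall i, (`| \int[nu]_(x in K) (f i x)%:E
                                   - \int[mu]_(x in K) (f i x)%:E | < eps%:E)%E].

Definition weak_open K (U : set PR) : Prop :=
  U `<=` PK K /\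
  forall mu, U mu -> exists (n : nat) (f : 'I_n -> 'rV[R]_d -> R) (eps : R),
    [/\ forall i, {within K, continuous (f i)}, 0 < eps & weak_nbhd K mu f eps `<=` U].

Definition weak_dense K (A : set PR) : Prop :=
  A `<=` PK K /\ forall V, weak_open K V -> V !=set0 -> (V `&` A) !=set0.

Definition typical K (P : PR -> Prop) : Prop :=
  exists U : nat -> set PR,
    [/\ forall n, weak_open K (U n), weak_dense K (\bigcap_n U n)
      & \bigcap_n U n `<=` P].

End Defs.

(* Main.v *)
(* Every equality splits into two inequalities. Those bounding [Dlow_minus] from below
   and [Dup_plus] from above hold for each measure of full support, by packing and
   pigeonhole. The others only require something at a sequence of scales, which is a
   countable family of weakly open conditions: some ball keeps mass [r^o(1)]; some ball
   has mass at most [r^m]; every ball of a minimal [r]-net carries an almost equal share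
   of the mass (which also yields full support); no ball carries more than the share
   obtained by spreading each atom uniformly over a separated set of nearby points.
   Finitely supported measures are weakly dense, and each condition is met after
   perturbing such a measure, realized as the law of a simple variable on [0, 1],
   by moving that variable little outside an event of small probability. Iterating
   the perturbations gives an almost surely convergent sequence, whose limit law
   satisfies all the conditions at once. *)
Require Import Defs.
From mathcomp Require Import all_boot all_order all_algebra finmap.
From mathcomp Require Import all_classical all_reals all_analysis measurable_realfun.
From mathcomp Require Import ring lra.
(* [Defs] is imported again because [urysohn] also defines an [edist]. *)
Import Defs numFieldNormedType.Exports.
Set Implicit Arguments. Unset Strict Implicit. Unset Printing Implicit Defensive.
Import Order.TTheory GRing.Theory Num.Theory.
Local Open Scope classical_set_scope.
Local Open Scope ring_scope.

(** * Euclidean balls and tent functions *)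

(** Two things make the conditions attainable inside any weak neighbourhood. First, multiplying a
    mass, a covering number or a radius by a constant adds only a bounded term to its logarithm,
    which disappears after division by [ln r] for small [r] ([small_ln_bound]); so pigeonhole
    losses, halved masses and the radius factors 2, 4, 8 are free. In particular a net may be given
    only a small fixed fraction of the mass: this moves the measure little and leaves its exponents
    unchanged. Secondly, making all balls light does require spreading the whole mass, so each atom
    may only be spread near its own place. How many separated points are available near each of
    finitely many atoms, at one common scale, is what the infimum over finite families in
    [upper_box_dim_loc_unif] records. The random choices in these perturbations come from cutting
    events into pieces of prescribed probability, which is possible on [0, 1] because the uniform
    law has no atoms. *)

Section EuclideanMetric.
Variables (R : realType) (d : nat).
Implicit Types (x y z : 'rV[R]_d) (r : R).

Lemma edist_ge0 x y : 0 <= edist x y.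
Proof. exact: sqrtr_ge0. Qed.

Lemma edistxx x : edist x x = 0.
Proof. by rewrite /edist big1 ?sqrtr0// => i _; rewrite subrr expr0n. Qed.

Lemma edistC x y : edist x y = edist y x.
Proof. by rewrite /edist; congr Num.sqrt; apply: eq_bigr => i _; ring. Qed.

Lemma sum_sqr_ge0 (a : 'I_d -> R) : 0 <= \sum_i a i ^+ 2.
Proof. by apply: sumr_ge0 => i _; exact: sqr_ge0. Qed.

(** Summing [(a i * B - b i * A) ^+ 2 >= 0] gives the inequality multiplied by [2 * (A * B)]; if [A]
    or [B] vanishes, so do all its coordinates. *)
Lemma cauchy_schwarz_sum (a b : 'I_d -> R) :
  \sum_i a i * b i <= Num.sqrt (\sum_i a i ^+ 2) * Num.sqrt (\sum_i b i ^+ 2).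
Proof.
set A := Num.sqrt (\sum_i a i ^+ 2); set B := Num.sqrt (\sum_i b i ^+ 2).
have A2 : \sum_i a i ^+ 2 = A ^+ 2 by rewrite sqr_sqrtr// sum_sqr_ge0.
have B2 : \sum_i b i ^+ 2 = B ^+ 2 by rewrite sqr_sqrtr// sum_sqr_ge0.
have zero (c : 'I_d -> R) : Num.sqrt (\sum_i c i ^+ 2) = 0 -> forall i, c i = 0.
  move=> /eqP; rewrite sqrtr_eq0 => c0 i; apply/eqP; rewrite -sqrf_eq0.
  by apply/eqP/(psumr_eq0P (P := predT) (F := fun i => c i ^+ 2)) => //;
    [move=> j _; exact: sqr_ge0 | apply/le_anti; rewrite c0 sum_sqr_ge0].
have [A0|A0] := eqVneq A 0.
  by rewrite A0 mul0r big1// => i _; rewrite (zero _ A0) mul0r.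
have [B0|B0] := eqVneq B 0.
  by rewrite B0 mulr0 big1// => i _; rewrite (zero _ B0) mulr0.
have Ap : 0 < A by rewrite lt_neqAle eq_sym A0 sqrtr_ge0.
have Bp : 0 < B by rewrite lt_neqAle eq_sym B0 sqrtr_ge0.
rewrite -(ler_pM2l (mulr_gt0 Ap Bp)) -(ler_pM2l (ltr0n R 2)).
have -> : 2 * (A * B * (A * B)) =
    \sum_i (a i ^+ 2 * B ^+ 2 + b i ^+ 2 * A ^+ 2).
  by rewrite big_split/= -!mulr_suml A2 B2; ring.
rewrite mulrA mulr_sumr; apply: ler_sum => i _.
have := sqr_ge0 (a i * B - b i * A); nra.
Qed.

Lemma edist_triangle y x z : edist x z <= edist x y + edist y z.
Proof.
rewrite -(@ler_pXn2r _ 2) ?nnegrE ?addr_ge0 ?edist_ge0//.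
rewrite sqrrD !sqr_sqrtr ?sum_sqr_ge0//.
have := cauchy_schwarz_sum (fun i => x ord0 i - y ord0 i)
  (fun i => y ord0 i - z ord0 i).
rewrite -/(edist x y) -/(edist y z) => cs.
have -> : \sum_i (x ord0 i - z ord0 i) ^+ 2 =
   \sum_i (x ord0 i - y ord0 i) ^+ 2 +
   (\sum_i (x ord0 i - y ord0 i) * (y ord0 i - z ord0 i)) *+ 2 +
   \sum_i (y ord0 i - z ord0 i) ^+ 2.
  by rewrite -sumrMnl -!big_split/=; apply: eq_bigr => i _; ring.
by rewrite lerD2r lerD2l lerMn2r.
Qed.

Lemma coord_le_edist x y i : `|x ord0 i - y ord0 i| <= edist x y.
Proof.
rewrite -sqrtr_sqr ler_sqrt ?sum_sqr_ge0//.
by rewrite (bigD1 i)//= lerDl; apply: sumr_ge0 => j _; exact: sqr_ge0.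
Qed.


Lemma edist_le_sup x y e : 0 <= e ->
  (forall i, `|x ord0 i - y ord0 i| <= e) -> edist x y <= d%:R * e.
Proof.
move=> e0 le_e; rewrite -(@ler_pXn2r _ 2) ?nnegrE ?mulr_ge0 ?edist_ge0//.
rewrite sqr_sqrtr ?sum_sqr_ge0// exprMn.
apply: (@le_trans _ _ (\sum_(i < d) e ^+ 2)).
  by apply: ler_sum => i _; rewrite -real_normK ?num_real// ler_pXn2r ?nnegrE.
rewrite sumr_const card_ord -[leLHS]mulr_natl ler_wpM2r ?sqr_ge0//.
rewrite -natrX ler_nat expnS expn1.
by have [->|d0] := posnP d; rewrite // leq_pmulr.
Qed.

Lemma eball_center x r : 0 < r -> eball x r x.
Proof. by rewrite /eball/= edistxx. Qed.

Lemma nbhs_eball x r : 0 < r -> nbhs x (eball x r).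
Proof.
(* Dividing by [d.+1] instead of [d] makes the final bound strict and covers [d = 0]. *)
move=> r0; apply/nbhs_ballP; exists (r / d.+1%:R) => /=; first by rewrite divr_gt0.
move=> y [_ xy]; rewrite /eball/=.
apply: (@le_lt_trans _ _ (d%:R * (r / d.+1%:R))); last first.
  by rewrite mulrCA gtr_pMr// ltr_pdivrMr// mul1r ltr_nat.
by apply: edist_le_sup => [|i]; [rewrite divr_ge0// ltW| apply/ltW/(xy ord0 i)].
Qed.

Lemma nbhs_eballP x (A : set 'rV[R]_d) :
  nbhs x A <-> exists2 r, 0 < r & eball x r `<=` A.
Proof.
split=> [|[r r0 rA]]; last exact: filterS rA (nbhs_eball x r0).
move=> /nbhs_ballP[r /= r0 rA]; exists r => // y xy; apply: rA; split=> // i j.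
by rewrite /ball/= ord1; apply: le_lt_trans xy; exact: coord_le_edist.
Qed.

Lemma eball_sub x y r s : edist x y + r <= s -> eball y r `<=` eball x s.
Proof.
move=> xyrs z; rewrite /eball/= => yz.
by apply: le_lt_trans (edist_triangle y _ _) _; apply: lt_le_trans xyrs; rewrite ltrD2l.
Qed.

Lemma open_eball x r : open (eball x r).
Proof.
rewrite openE => y xy; apply/nbhs_eballP; exists (r - edist x y).
  by rewrite subr_gt0.
by apply: eball_sub; rewrite addrC subrK.
Qed.

Lemma edist_lipschitz x y z : `|edist x y - edist x z| <= edist y z.
Proof.
have := edist_triangle y x z; have := edist_triangle z x y.
by rewrite (edistC z y) ler_norml => ? ?; apply/andP; split; lra.
Qed.

(** A continuous function squeezed between half the indicator of the ball of radius [r / 2] and the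
    indicator of the ball of radius [r], so that its integral controls ball masses from both
    sides. *)
Definition tent x r y : R := Num.max 0 (1 - edist x y / r).

Lemma tent_continuous x r : 0 < r -> continuous (tent x r).
Proof.
move=> r0 y A /nbhs_ballP[e /= e0 eA].
apply: filterS (nbhs_eball y (mulr_gt0 e0 r0)) => z yz; apply: eA.
have : `|edist x y / r - edist x z / r| < e.
  rewrite -mulrBl normrM [X in _ * X]gtr0_norm ?invr_gt0// ltr_pdivrMr//.
  exact: le_lt_trans (edist_lipschitz _ _ _) _.
rewrite /ball/= /tent /Num.max !ltr_norml => /andP[].
by case: ifP; case: ifP => *; apply/andP; split; lra.
Qed.

Lemma tent_ge0 x r y : 0 <= tent x r y.
Proof. by rewrite /tent le_max lexx. Qed.

Lemma tent_le1 x r y : 0 < r -> tent x r y <= 1.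
Proof.
by move=> r0; rewrite /tent ge_max ler01/= gerBl divr_ge0 ?edist_ge0// ltW.
Qed.

Lemma tentxx x r : tent x r x = 1.
Proof. by rewrite /tent edistxx mul0r subr0 max_r. Qed.

Lemma tent_eq0 x r y : 0 < r -> r <= edist x y -> tent x r y = 0.
Proof. by move=> r0 rxy; rewrite /tent max_l// subr_le0 ler_pdivlMr// mul1r. Qed.

Lemma tent_ge_half x r y : 0 < r -> edist x y < r -> 1 / 2 <= tent x (2 * r) y.
Proof.
move=> r0 rxy; rewrite /tent le_max; apply/orP; right.
have : edist x y / (2 * r) <= 1 / 2 by rewrite ler_pdivrMr ?mulr_gt0//; lra.
lra.
Qed.

End EuclideanMetric.

(** * Integrals of continuous functions against laws *)

Section WeakTopology.
Variables (R : realType) (d : nat).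
Local Notation BR := (BorelRd R d).
Local Notation PR := (probability BR R).
Implicit Types (K : set 'rV[R]_d) (f : 'rV[R]_d -> R).

Lemma measurable_open (U : set 'rV[R]_d) : open U -> measurable (U : set BR).
Proof. by move=> oU; exact: sub_sigma_algebra. Qed.

Lemma measurable_closed (U : set 'rV[R]_d) : closed U -> measurable (U : set BR).
Proof.
move=> cU; rewrite -[U]setCK; apply: measurableC.
by apply: measurable_open; exact: closed_openC.
Qed.

Lemma measurable_eball x r : measurable (eball x r : set BR).
Proof. by apply: measurable_open; exact: open_eball. Qed.

Lemma edist_eq0 (x y : 'rV[R]_d) : edist x y = 0 -> x = y.
Proof.
move=> xy0; apply/rowP => i; apply/eqP; rewrite -subr_eq0 -normr_le0 -xy0.
exact: coord_le_edist.
Qed.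

Lemma compact_closed_rV K : compact K -> closed K.
Proof.
apply: compact_closed => x y xy; apply: edist_eq0; apply/eqP/contraT => nxy.
have r0 : 0 < edist x y / 2 by rewrite divr_gt0// lt_neqAle eq_sym nxy edist_ge0.
have [z [xz yz]] := xy _ _ (nbhs_eball x r0) (nbhs_eball y r0).
have := edist_triangle z x y; rewrite (edistC z y).
by move: xz yz; rewrite /eball/=; lra.
Qed.

Lemma measurable_compact K : compact K -> measurable (K : set BR).
Proof. by move=> cK; apply: measurable_closed; exact: compact_closed_rV. Qed.

Lemma within_continuous_measurable K f : compact K ->
  {within K, continuous f} -> measurable_fun (K : set BR) f.
Proof.
move=> cK /continuousP cf; have mK := measurable_compact cK.
apply: (measurability _ (RGenOpens.measurableE R)).
move=> _ [_ [a [b ->] <-]].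
have /open_subspaceP[V oV VK] :
  open (f @^-1` `]a, b[%classic : set (subspace K)) by exact/cf/interval_open.
by rewrite setIC -VK; apply: measurableI => //; exact: measurable_open.
Qed.

Lemma within_continuousP K f x e : {within K, continuous f} -> K x -> 0 < e ->
  exists2 r : R, 0 < r & forall y, K y -> edist x y < r -> `|f x - f y| < e.
Proof.
move=> cf Kx e0; have := cf x (ball (f x) e) (nbhsx_ballx _ _ e0).
rewrite /nbhs/= -nbhs_subspace_in// => /nbhs_eballP[r r0 rK].
by exists r => // y Ky xy; exact: rK.
Qed.

(** Compactness enters as a near-covering property along the filter of positive radii tending to 0:
    a radius that works near each point yields one that works on all of [K]. *)
Lemma uniformly_continuous_compact K f : compact K -> {within K, continuous f} ->
  forall e, 0 < e -> exists2 r : R, 0 < r &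
    forall x y, K x -> K y -> edist x y <= r -> `|f x - f y| < e.
Proof.
move=> cK cf e e0.
pose P r x := K x -> forall y, K y -> edist x y <= r -> `|f x - f y| < e.
have : \forall r \near 0^'+, K `<=` P r.
  have /compact_near_coveringP := cK; apply => x Kx.
  have e2 : 0 < e / 2 by rewrite divr_gt0.
  have [r r0 rf] := within_continuousP cf Kx e2.
  have r2 : 0 < r / 2 by rewrite divr_gt0.
  exists (eball x (r / 2), [set s : R | s < r / 2]) => /=.
    by split; [exact: nbhs_eball|exact: nbhs_right_lt].
  move=> [y s] [/= xy sr] Ky z Kz yz.
  have xy' : edist x y < r by move: xy; rewrite /eball/=; lra.
  have xz : edist x z < r.
    by have := edist_triangle y x z; move: xy yz; rewrite /eball/=; lra.
  have := rf _ Ky xy'; have := rf _ Kz xz; rewrite !ltr_norml.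
  by move=> /andP[? ?] /andP[? ?]; apply/andP; split; lra.
move=> /(filterI (nbhs_right_gt (0 : R))) /filter_ex[r [/= r0 rP]].
by exists r => // x y Kx; exact: rP.
Qed.

Lemma bounded_compact K f : compact K -> {within K, continuous f} ->
  exists2 M : R, 0 < M & forall x, K x -> `|f x| <= M.
Proof.
move=> cK cf; have : \forall M \near +oo, K `<=` (fun x => K x -> `|f x| <= M).
  have /compact_near_coveringP := cK; apply => x Kx.
  have [r r0 rf] := within_continuousP cf Kx ltr01.
  exists (eball x r, [set M : R | `|f x| + 1 < M]) => /=.
    by split; [exact: nbhs_eball|apply: nbhs_pinfty_gt; rewrite num_real].
  move=> [y M] [/= xy sM] Ky; apply/ltW/(le_lt_trans _ sM).
  have := rf _ Ky xy; rewrite distrC; have := ler_normD (f y - f x) (f x).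
  by rewrite subrK; lra.
move=> /(filterI (nbhs_pinfty_gt (num_real 0))) /filter_ex[M [/= M0 MP]].
by exists M => // x Kx; exact: MP.
Qed.

Lemma restrict_measurable K f : compact K -> {within K, continuous f} ->
  measurable_fun [set: BR] (f \_ K).
Proof.
move=> cK cf; apply/(measurable_restrictT _ (measurable_compact cK)).
exact: within_continuous_measurable.
Qed.

Section Laws.
Context {dW} {W : measurableType dW} (P : probability W R).
Implicit Types Y Z : {mfun W >-> BR}.

Lemma law_integrable K f Y : compact K -> {within K, continuous f} ->
  P.-integrable setT (EFin \o (f \_ K \o Y)).
Proof.
move=> cK cf; have [M M0 fM] := bounded_compact cK cf.
apply: measurable_bounded_integrable => //.
- exact: fin_num_fun_lty.
- apply: measurableT_comp => //; exact: (restrict_measurable cK cf).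
- exists M; split; rewrite ?num_real// => N MN w _ /=.
  rewrite patchE; case: ifPn => [/set_mem /fM/le_trans->//|_]; first exact: ltW.
  by rewrite normr0 ltW// (lt_trans M0).
Qed.

Lemma integral_law K f Y : compact K -> {within K, continuous f} ->
  (\int[distribution P Y]_(x in K) (f x)%:E = \int[P]_w ((f \_ K) (Y w))%:E)%E.
Proof.
move=> cK cf; rewrite integral_mkcond restrict_EFin integral_distribution//.
- by apply/measurable_EFinP; exact: restrict_measurable.
- exact: law_integrable.
Qed.

(** Closeness in probability implies weak closeness. The threshold [eta] is fixed before [Y], [Z]
    and [E], so one [eta] serves for all later perturbations. Nothing is asked on [E], where the
    extension of [f] by zero is still bounded. *)
Lemma law_close K f e : compact K -> {within K, continuous f} -> 0 < e ->
  exists2 eta : R, 0 < eta & forall Y Z (E : set W), measurable E ->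
    (P E <= eta%:E)%E ->
    (forall w, ~ E w -> [/\ K (Y w), K (Z w) & edist (Y w) (Z w) <= eta]) ->
    (`|\int[distribution P Y]_(x in K) (f x)%:E -
       \int[distribution P Z]_(x in K) (f x)%:E| < e%:E)%E.
Proof.
move=> cK cf e0; have [M M0 fM] := bounded_compact cK cf.
have [r r0 rf] := uniformly_continuous_compact cK cf (divr_gt0 e0 (ltr0n R 3)).
have e6M : 0 < e / (6 * M) by rewrite divr_gt0// mulr_gt0.
(* The error is at most [e / 3] off [E] and [2 * M] on [E], hence at most [e / 3 + 2 * M * (e / (6 *
   M)) = 2 * e / 3] in total. *)
exists (Num.min r (e / (6 * M))); first by rewrite lt_min r0.
move=> Y Z E mE PE YZ; rewrite !integral_law//.
pose F := f \_ K; pose h w := F (Y w) - F (Z w).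
have mF : measurable_fun [set: BR] F by exact: restrict_measurable.
have mh : measurable_fun setT h by apply: measurable_funB; exact: measurableT_comp.
have FM x : `|F x| <= M.
  by rewrite /F patchE; case: ifPn => [/set_mem/fM//|_]; rewrite normr0 ltW.
rewrite -integralB_EFin//; try exact: law_integrable.
under eq_integral do rewrite -EFinB -/(h _).
apply: le_lt_trans (le_abse_integral _ _ _) _ => //.
  exact/measurable_EFinP.
apply: (@le_lt_trans _ _
    (\int[P]_w ((e / 3)%:E + (2 * M)%:E * (\1_E w)%:E))%E).
  apply: ge0_le_integral => //.
  - by apply: measurableT_comp => //; exact/measurable_EFinP.
  - apply: emeasurable_funD => //; apply: emeasurable_funM => //.
    exact/measurable_EFinP/measurable_indic.
  - move=> w _; rewrite abse_EFin -EFinM -EFinD lee_fin indicE.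
    have [wE|wE] := boolP (w \in E); rewrite /= ?mulr1 ?mulr0 ?addr0.
      have := ler_normB (F (Y w)) (F (Z w)); have := FM (Y w); have := FM (Z w).
      by rewrite /h; lra.
    have [KY KZ dYZ] : [/\ K (Y w), K (Z w) &
        edist (Y w) (Z w) <= Num.min r (e / (6 * M))].
      by apply: YZ => /mem_set; exact/negP.
    rewrite /h /F !patchE !mem_set//; apply/ltW/rf => //.
    by apply: le_trans dYZ _; rewrite ge_min lexx.
rewrite ge0_integralD//; last 2 first.
- by move=> w _; rewrite -EFinM lee_fin mulr_ge0// mulr_ge0// ltW.
- apply: emeasurable_funM => //.
  exact/measurable_EFinP/measurable_indic.
rewrite integral_cst// ge0_integralZl_EFin//; last 2 first.
- exact/measurable_EFinP/measurable_indic.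
- by rewrite mulr_ge0// ltW.
rewrite integral_indic// setIT.
apply: (@le_lt_trans _ _ ((e / 3)%:E * P setT + (2 * M)%:E * P E)%E).
  exact: lexx.
rewrite probability_setT mule1.
apply: (@le_lt_trans _ _ ((e / 3)%:E + (2 * M)%:E * (e / (6 * M))%:E)%E).
  apply: leeD; first exact: lexx.
  apply: lee_pmul => //; first by rewrite lee_fin mulr_ge0// ltW.
  by apply: le_trans PE _; rewrite lee_fin ge_min lexx orbT.
rewrite -EFinM -EFinD lte_fin.
have -> : 2 * M * (e / (6 * M)) = e / 3 by field; rewrite gt_eqF.
lra.
by move=> *; rewrite lee_fin divr_ge0// ltW.
Qed.

End Laws.
End WeakTopology.

(** * Weakly open sets *)

Section OpenSets.
Variables (R : realType) (d : nat).
Local Notation BR := (BorelRd R d).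
Local Notation PR := (probability BR R).
Variable K : set 'rV[R]_d.
Hypothesis cK : compact K.
Implicit Types (nu : PR) (f : 'rV[R]_d -> R).

Lemma weak_open_bigcup (I : Type) (D : set I) (U : I -> set PR) :
  (forall i, D i -> weak_open K (U i)) -> weak_open K (\bigcup_(i in D) U i).
Proof.
move=> oU; split=> [nu [i Di]|nu [i Di Unu]]; first exact: (oU i Di).1.
have [n [f [e [cf e0 feU]]]] := (oU i Di).2 nu Unu.
exists n, f, e; split=> // x /feU; exact: bigcup_sup.
Qed.

Lemma finite_lower_bound n (e : 'I_n -> R) :
  (forall i, 0 < e i) -> exists2 r, 0 < r & forall i, r <= e i.
Proof.
move=> e0; exists (\big[Order.min/1]_i e i).
  by apply: lt_bigmin.
by move=> i; apply: bigmin_le_cond.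
Qed.

Lemma within_continuous_integrable nu f : {within K, continuous f} ->
  nu.-integrable K (EFin \o f).
Proof.
move=> cf; have [M M0 fM] := bounded_compact cK cf.
apply: measurable_bounded_integrable => //.
- exact: measurable_compact.
- by rewrite (le_lt_trans (probability_le1 _ _)) ?ltry//; exact: measurable_compact.
- exact: within_continuous_measurable.
- exists M; split; rewrite ?num_real// => N MN w Kw /=.
  by rewrite ltW// (le_lt_trans (fM _ Kw)).
Qed.

Lemma integral_fin_num nu f : {within K, continuous f} ->
  (\int[nu]_(x in K) (f x)%:E)%E \is a fin_num.
Proof.
move=> cf; apply: integrable_fin_num; first exact: measurable_compact.
exact: within_continuous_integrable.
Qed.

Lemma weak_open_integral_itv n (f : 'I_n -> 'rV[R]_d -> R) (a b : 'I_n -> R) :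
  (forall i, {within K, continuous f i}) ->
  weak_open K [set nu | PK K nu /\ forall i,
    (a i)%:E < \int[nu]_(x in K) (f i x)%:E < (b i)%:E]%E.
Proof.
move=> cf; split=> [nu []//|nu [nuK ab]].
pose I i := fine (\int[nu]_(x in K) (f i x)%:E)%E.
have IE i : (\int[nu]_(x in K) (f i x)%:E)%E = (I i)%:E.
  by rewrite /I fineK// integral_fin_num.
have [e e0 eI] : exists2 e : R, 0 < e & forall i, e <= Num.min (I i - a i) (b i - I i).
  apply: finite_lower_bound => i; move: (ab i).
  by rewrite IE !lte_fin lt_min !subr_gt0.
exists n, f, e; split=> // nu' [nu'K close]; split=> // i.
have := close i; have := eI i; rewrite IE le_min.
rewrite -(fineK (integral_fin_num nu' (cf i))).
rewrite -EFinB abse_EFin !lte_fin ltr_norml => /andP[? ?] /andP[? ?].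
by apply/andP; split; lra.
Qed.

Lemma tent_within z r : 0 < r -> {within K, continuous (tent z r)}.
Proof. by move=> r0; apply: continuous_subspaceT; exact: tent_continuous. Qed.

Lemma measurable_tent z r : 0 < r ->
  measurable_fun (K : set BR) (fun x => (tent z r x)%:E).
Proof.
move=> r0; apply/measurable_EFinP; apply: within_continuous_measurable => //.
exact: tent_within.
Qed.

Lemma PK_setI nu (A : set BR) : PK K nu -> measurable A -> nu (A `&` K) = nu A.
Proof.
move=> nuK mA; have mK : measurable (K : set BR) by exact: measurable_compact.
have nuKC : nu (~` K) = 0%E.
  by rewrite probability_setC// nuK subee.
have nuAK : nu (A `\` K) = 0%E.
  apply: (subset_measure0 (measurableD mA mK) (measurableC mK)) nuKC.
  by move=> x [].
have -> : nu A = (nu (A `\` K) + nu (A `&` K))%E by exact: measureDI.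
by rewrite nuAK add0e.
Qed.

Lemma integral_tent_le nu z r : PK K nu -> 0 < r ->
  (\int[nu]_(x in K) (tent z r x)%:E <= nu (eball z r))%E.
Proof.
move=> nuK r0; have mK := measurable_compact cK; have mB := measurable_eball z r.
rewrite -(PK_setI nuK mB) -integral_indic//; apply: ge0_le_integral => //.
- by move=> x _; rewrite lee_fin tent_ge0.
- exact: measurable_tent.
- exact/measurable_EFinP/measurable_indic.
- move=> x _; rewrite lee_fin indicE.
  have [_|/negP] := boolP (x \in eball z r); first exact: tent_le1.
  by move=> xB; rewrite tent_eq0// leNgt; apply/negP => zx; apply/xB/mem_set.
Qed.

Lemma integral_tent_ge nu z r : PK K nu -> 0 < r ->
  (nu (eball z r) <= 2%:E * \int[nu]_(x in K) (tent z (2 * r) x)%:E)%E.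
Proof.
move=> nuK r0; have mK := measurable_compact cK; have mB := measurable_eball z r.
have r20 : 0 < 2 * r by rewrite mulr_gt0.
have mt := measurable_tent z r20.
rewrite -(PK_setI nuK mB) -integral_indic// -ge0_integralZl_EFin//; last first.
  by move=> x _; rewrite lee_fin tent_ge0.
apply: ge0_le_integral => //.
- exact/measurable_EFinP/measurable_indic.
- by apply: emeasurable_funM.
- move=> x _; rewrite -EFinM lee_fin indicE.
  have [/set_mem xB|_] := boolP (x \in eball z r); last by rewrite mulr_ge0 ?tent_ge0.
  by have := tent_ge_half r0 xB; rewrite /=; lra.
Qed.

Lemma integral_tent_ge1 nu z r : K z -> 0 < r ->
  (nu [set z] <= \int[nu]_(x in K) (tent z r x)%:E)%E.
Proof.
move=> Kz r0; have mK := measurable_compact cK.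
have mz : measurable ([set z] : set BR).
  rewrite (_ : [set z] = \bigcap_(n : nat) eball z (n.+1%:R^-1)).
    by apply: bigcapT_measurable => n; exact: measurable_eball.
  apply/seteqP; split=> [x -> n _|x zx]; first exact: eball_center.
  apply/esym/edist_eq0/eqP; rewrite eq_le edist_ge0 andbT.
  apply/ler_addgt0Pl => e e0; rewrite addr0.
  have [n _ ne] := near_infty_natSinv_lt (PosNum e0).
  have {}ne := ne n (leqnn n).
  exact/ltW/lt_trans/ne/zx.
have -> : nu [set z] = nu ([set z] `&` K).
  by congr (nu _); apply/esym/setIidl => x ->.
rewrite -integral_indic//; apply: ge0_le_integral => //.
- exact/measurable_EFinP/measurable_indic.
- exact: measurable_tent.
- move=> x _; rewrite lee_fin indicE.
  by have [/set_mem ->|_] := boolP (x \in [set z]); rewrite ?tentxx ?tent_ge0.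
Qed.

Lemma weak_open_tent_gt n (z : 'I_n -> 'rV[R]_d) (r : R) (a : 'I_n -> R) : 0 < r ->
  weak_open K [set nu | PK K nu /\ forall i,
    (a i)%:E < \int[nu]_(x in K) (tent (z i) r x)%:E]%E.
Proof.
move=> r0.
(* The upper end [2] excludes nothing, as a tent integrates to at most 1; the lower end [-1] does
   the same in the next lemma. *)
have := weak_open_integral_itv a (fun=> 2) (fun i => tent_within (z := z i) r0).
congr weak_open; apply/seteqP; split=> nu [nuK ab]; split=> // i.
  by have /andP[] := ab i.
rewrite ab/=; apply: le_lt_trans (integral_tent_le _ nuK r0) _.
apply: le_lt_trans (probability_le1 _ _) _; first exact: measurable_eball.
by rewrite lte_fin ltr1n.
Qed.

Lemma weak_open_tent_lt n (z : 'I_n -> 'rV[R]_d) (r : R) (b : 'I_n -> R) : 0 < r ->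
  weak_open K [set nu | PK K nu /\ forall i,
    \int[nu]_(x in K) (tent (z i) r x)%:E < (b i)%:E]%E.
Proof.
move=> r0.
have := weak_open_integral_itv (fun=> -1) b (fun i => tent_within (z := z i) r0).
congr weak_open; apply/seteqP; split=> nu [nuK ab]; split=> // i.
  by have /andP[] := ab i.
rewrite ab andbT; apply: (@lt_le_trans _ _ 0%E); first by rewrite lte_fin ltrN10.
by apply: integral_ge0 => x _; rewrite lee_fin tent_ge0.
Qed.

End OpenSets.

(** * Divisible probability spaces and discrete variables *)

Section Uniform01.
Variable R : realType.
Local Notation W := (measurableTypeR R).
Local Notation P := (uniform_prob (@ltr01 R)).

Lemma uniform01_le_lebesgue (A : set W) : measurable A ->
  (P A <= lebesgue_measure A)%E.
Proof.
move=> mA; rewrite -[leRHS]mul1e -integral_cst// /uniform_prob.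
apply: ge0_le_integral => //.
- by move=> x _; rewrite lee_fin uniform_pdf_ge0.
- apply/measurable_EFinP/measurable_funTS; exact: measurable_uniform_pdf.
- move=> x _; rewrite lee_fin /uniform_pdf subr0 invr1.
  by case: ifP => // _; exact: ler01.
Qed.

Lemma uniform01_out (A : set W) : measurable A ->
  (forall x, A x -> ~~ (0 <= x <= 1)) -> P A = 0%E.
Proof.
move=> mA outA; rewrite /uniform_prob integral0_eq// => x Ax.
by rewrite /uniform_pdf (negbTE (outA _ Ax)).
Qed.

(** Sierpinski's property of atomless measures. *)
Definition divisible {dW} {V : measurableType dW} (Q : probability V R) :=
  forall (A : set V) (c : R), measurable A -> 0 <= c -> (c%:E <= Q A)%E ->
    exists B, [/\ measurable B, B `<=` A & Q B = c%:E].

(** The function [t |-> Q (A]&[]-oo, t])] is 1-Lipschitz by domination, so it takes every value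
    between 0 and [Q A]. *)
Lemma lebesgue_dominated_divisible (Q : probability W R) :
  (forall A, measurable A -> (Q A <= lebesgue_measure A)%E) ->
  (forall A : set W, measurable A -> (forall x, A x -> ~~ (0 <= x <= 1)) ->
    Q A = 0%E) ->
  divisible Q.
Proof.
move=> Qleb Qout A c mA c0 cA.
pose g t := fine (Q (A `&` `]-oo, t])).
have mAt t : measurable (A `&` `]-oo, t] : set W) by exact: measurableI.
have gE t : Q (A `&` `]-oo, t]) = (g t)%:E.
  by rewrite /g fineK// fin_num_measure.
have gD s t : s <= t -> 0 <= g t - g s <= t - s.
  move=> st.
  have mAst : measurable (A `&` `]s, t] : set W) by exact: measurableI.
  have : Q (A `&` `]-oo, t]) = (Q (A `&` `]-oo, s]) + Q (A `&` `]s, t]))%E.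
    rewrite -measureU//; last first.
      rewrite -subset0 => x [[_ xs] [_ xt]]; move: xs xt.
      by rewrite /= !in_itv/= => xs; rewrite ltNge xs.
    congr (Q _); rewrite -setIUr; congr (_ `&` _).
    apply/seteqP; split=> x; rewrite /= !in_itv/=.
      by move=> xt; have [xs|xs] := leP x s; [left|right; rewrite xt].
    by move=> [xs|/andP[]//]; exact: le_trans st.
  have [q q0 qE] : exists2 q : R, 0 <= q & Q (A `&` `]s, t]) = q%:E.
    by exists (fine (Q (A `&` `]s, t]))); rewrite ?fine_ge0// fineK// fin_num_measure.
  rewrite !gE qE -EFinD => -[->]; rewrite addrAC subrr add0r q0/= -lee_fin -qE.
  have QI : (Q (A `&` `]s, t]) <= Q `]s, t]%classic)%E.
    by apply: le_measure; rewrite ?inE//; exact: subIsetr.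
  apply: (le_trans QI); apply: (le_trans (Qleb _ _)) => //.
  rewrite lebesgue_measure_itv/= lte_fin; case: ifP => // /negbT.
  by rewrite -leNgt lee_fin subr_ge0.
have cg : {within `[(- 1), 1], continuous g}.
  apply: continuous_subspaceT => x.
  apply/cvgrPdist_le => e e0; near=> y.
  have : `|x - y| <= e by near: y; exact: cvgr_dist_le.
  have [xy|/ltW xy] := leP x y.
    have /andP[g0 g1] := gD _ _ xy.
    rewrite (distrC x) (distrC (g x)) !ger0_norm ?subr_ge0//.
      by apply: le_trans.
    by rewrite -subr_ge0.
  have /andP[g0 g1] := gD _ _ xy.
  by rewrite !ger0_norm ?subr_ge0//; [exact: le_trans|rewrite -subr_ge0].
(* Starting at [-1] makes the initial set disjoint from [0, 1], hence null by [Qout]; at 0 it could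
   contain the point 0. *)
have N11 : -1 <= (1 : R) by lra.
have gN1 : g (-1) = 0.
  rewrite /g Qout// => x [_ /=]; rewrite in_itv/= => x1.
  by rewrite negb_and -ltNge; apply/orP; left; lra.
have g1 : (g 1)%:E = Q A.
  rewrite -gE; apply/eqP; rewrite eq_le; apply/andP; split.
    by apply: le_measure; rewrite ?inE//; exact: subIsetl.
  pose I1 : set W := `]-oo, 1]%classic.
  have mI1 : measurable I1 by exact: measurable_itv.
  have mAC : measurable (A `\` I1) by apply: measurableD.
  have -> : Q A = (Q (A `\` I1) + Q (A `&` I1))%E by exact: measureDI.
  rewrite Qout ?add0e// => x [_]; rewrite /I1/= in_itv/= => /negP.
  by rewrite negb_and => ->; rewrite orbT.
have [|t _ gt] := @IVT _ g (-1) 1 c N11 cg.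
  have cg1 : c <= g 1 by rewrite -lee_fin g1.
  by rewrite gN1 ge_min c0/= le_max cg1 orbT.
by exists (A `&` `]-oo, t]); split=> //; rewrite ?gE ?gt//; exact: subIsetl.
Unshelve. all: by end_near. Qed.

Lemma uniform01_divisible : divisible P.
Proof.
apply: lebesgue_dominated_divisible; first exact: uniform01_le_lebesgue.
exact: uniform01_out.
Qed.

End Uniform01.

Section DiscreteVariables.
Context {R : realType} {dW : measure_display} {W : measurableType dW}.
Variable P : probability W R.

(** Preimages of all subsets are required to be measurable, so [T] carries no sigma-algebra and any
    function of discrete variables is again discrete. *)
Definition discrete T (X : W -> T) :=
  finite_set (range X) /\ forall S : set T, measurable (X @^-1` S).

Lemma discrete_cst T (x : T) : discrete (fun=> x).
Proof.
split=> [|S].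
  by apply: (@sub_finite_set _ _ [set x]) => // _ [w _ <-].
have [xS|xS] := pselect (S x).
  by rewrite (_ : _ @^-1` S = setT)//; apply/seteqP; split.
by rewrite (_ : _ @^-1` S = set0)//; apply/seteqP; split.
Qed.

Lemma discrete_comp2 T1 T2 T3 (F : T1 -> T2 -> T3) (X : W -> T1) (Y : W -> T2) :
  discrete X -> discrete Y -> discrete (fun w => F (X w) (Y w)).
Proof.
move=> [fX mX] [fY mY]; have fXY := finite_setX fX fY; split=> [|S].
  apply: sub_finite_set (finite_image (fun p => F p.1 p.2) fXY).
  by move=> _ [w _ <-]; exists (X w, Y w).
rewrite (_ : _ @^-1` S = \bigcup_(p in (range X `*` range Y) `&`
    [set p | S (F p.1 p.2)]) (X @^-1` [set p.1] `&` Y @^-1` [set p.2])).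
  apply: fin_bigcup_measurable; first exact: finite_setIl.
  by move=> p _; apply: measurableI.
apply/seteqP; split=> [w Sw|w [[x y] [/= _ Sxy] [/= -> ->]]//].
by exists (X w, Y w) => //; split=> //; split; exists w.
Qed.

Lemma discrete_mem (B : set W) : measurable B -> discrete (fun w => w \in B).
Proof.
move=> mB; split=> [|S].
  exact: sub_finite_set (@finite_finset _ [set: bool]).
rewrite (_ : _ @^-1` S =
    (B `&` (fun=> true) @^-1` S) `|` (~` B `&` (fun=> false) @^-1` S)).
  have mC b : measurable ((fun _ : W => b) @^-1` S) by exact: (discrete_cst b).2.
  apply: measurableU; first exact: measurableI.
  by apply: measurableI => //; exact: measurableC.
apply/seteqP; split=> w /=.
  by have [/set_mem wB|/negP wB] := boolP (w \in B); [left|right; split=> // /mem_set].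
by move=> [[wB]|[wB]]; rewrite ?(mem_set wB)// memNset.
Qed.

Lemma discrete_if T (B : set W) (X Y : W -> T) : measurable B ->
  discrete X -> discrete Y -> discrete (fun w => if w \in B then X w else Y w).
Proof.
move=> mB dX dY; have dXY := discrete_comp2 pair dX dY.
exact: (discrete_comp2 (fun (b : bool) xy => if b then xy.1 else xy.2)
  (discrete_mem mB) dXY).
Qed.

Lemma measure_discrete (T : choiceType) (X : W -> T) (A : set W) (D : set T) :
  discrete X -> measurable A -> finite_set D -> range X `<=` D ->
  P A = (\sum_(x \in D) P (X @^-1` [set x] `&` A))%E.
Proof.
move=> [_ mX] mA fD XD; rewrite -measure_fin_bigcup//.
- congr (P _); apply/seteqP; split=> [w Aw|w [x _ []]//].
  by exists (X w) => //; apply: XD; exists w.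
- by move=> x y _ _ [w [[/= <- _] [/= <- _]]].
- by move=> x _; exact: measurableI.
Qed.

(** Total probability: a bound on the conditional probability given each value of [X] bounds the
    probability. *)
Lemma measure_discrete_le (T : choiceType) (X : W -> T) (A : set W) (c : R) :
  discrete X -> measurable A -> 0 <= c ->
  (forall x, P (X @^-1` [set x] `&` A) <= c%:E * P (X @^-1` [set x]))%E ->
  (P A <= c%:E)%E.
Proof.
move=> [fX mX] mA c0 Ac.
have PE B : measurable B ->
    P B = (\sum_(x \in range X) P (X @^-1` [set x] `&` B))%E.
  by move=> mB; exact: measure_discrete.
rewrite PE//; apply: (@le_trans _ _ (\sum_(x \in range X) c%:E * P (X @^-1` [set x]))%E).
  by apply: lee_fsum.
rewrite -ge0_mule_fsumr; last by move=> x; exact: measure_ge0.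
have -> : (\sum_(x \in range X) P (X @^-1` [set x]) = P setT)%E.
  by rewrite (PE setT)//; apply: eq_fsbigr => x _; rewrite setIT.
by rewrite probability_setT mule1.
Qed.

Lemma discrete_atom (T : choiceType) (X : W -> T) : discrete X ->
  exists w, (0 < P (X @^-1` [set X w]))%E.
Proof.
move=> dX; apply/not_existsP => noatom.
have P0 x : P (X @^-1` [set x]) = 0%E.
  have [[w _ <-]|nx] := pselect (range X x).
    have /negP := noatom w; rewrite -leNgt => Pw.
    by apply/eqP; rewrite eq_le Pw measure_ge0.
  rewrite (_ : _ @^-1` _ = set0) ?measure0//; apply/seteqP; split=> // w Xw.
  by apply: nx; exists w.
have := measure_discrete_le dX measurableT (lexx 0) => /(_ _)/wrap[x|].
  by rewrite setIT P0 mule0.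
by rewrite probability_setT lee_fin ler10.
Qed.

End DiscreteVariables.

(** * Random labels obtained by splitting events *)

Section Splitting.
Context {R : realType} {dW : measure_display} {W : measurableType dW}.
Variable P : probability W R.
Hypothesis divP : divisible P.

(** Divisibility carves out the piece labelled [n.+1], and induction splits the rest of [A]. *)
Lemma measurable_split n (A : set W) (c : nat -> R) : measurable A ->
  (forall j, 0 <= c j) -> P A = (\sum_(j < n.+1) c j)%:E ->
  exists h : W -> nat, [/\ discrete h, forall w, (h w <= n)%N &
    forall j, (j <= n)%N -> P (A `&` h @^-1` [set j]) = (c j)%:E].
Proof.
move=> + c0; elim: n A => [|n IH] A mA PA.
  exists (fun=> 0%N); split=> // [|j]; first exact: discrete_cst.
  rewrite leqn0 => /eqP ->; rewrite (_ : _ @^-1` _ = setT).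
    by rewrite setIT PA big_ord1.
  by apply/seteqP; split.
move: PA; rewrite big_ord_recr/= => PA.
have cA : ((c n.+1)%:E <= P A)%E by rewrite PA lee_fin lerDr sumr_ge0.
have [B [mB BA PB]] := divP mA (c0 _) cA.
have [|h [dh hn Ph]] := IH (A `\` B) (measurableD mA mB).
  have : P A = (P (A `\` B) + P (A `&` B))%E by exact: measureDI.
  rewrite (setIidr BA) PA PB => AB.
  have : P (A `\` B) \is a fin_num.
    by apply: fin_num_measure; exact: measurableD.
  by move: AB; case: (P (A `\` B)) => // r; rewrite -EFinD => -[/addIr ->].
exists (fun w => if w \in B then n.+1 else h w); split=> [|w|j].
- by apply: discrete_if => //; exact: discrete_cst.
- by case: ifP => // _; exact: leqW.
- rewrite leq_eqVlt => /predU1P[->|]; last first.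
    rewrite ltnS => jn; rewrite -(Ph _ jn); congr (P _); apply/seteqP; split=> w /=.
      move=> [Aw]; have [_ jn1|/negP wB <-] := boolP (w \in B).
        by move: jn; rewrite -jn1 ltnn.
      by split=> //; split=> // /mem_set.
    by move=> [[Aw wB] <-]; rewrite memNset.
  rewrite -PB; congr (P _); apply/seteqP; split=> w /=.
    move=> [Aw]; have [/set_mem//|_ hw] := boolP (w \in B).
    by have := hn w; rewrite hw ltnn.
  by move=> Bw; rewrite mem_set//; split=> //; exact: BA.
Qed.

(** A uniform label in [0..n] independent of [X]: each fibre of [X] is cut into [n.+1] equal parts
    and the labellings are glued along [X]. *)
Lemma fresh_index T (X : W -> T) n : discrete X ->
  exists h : W -> nat, [/\ discrete h, forall w, (h w <= n)%N &
    forall x j, (j <= n)%N -> P (X @^-1` [set x] `&` h @^-1` [set j]) =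
      (n.+1%:R^-1%:E * P (X @^-1` [set x]))%E].
Proof.
move=> [fX mX].
have /choice[g gP] x : exists h : W -> nat, [/\ forall S, measurable (h @^-1` S),
    forall w, (h w <= n)%N &
    forall j, (j <= n)%N -> P (X @^-1` [set x] `&` h @^-1` [set j]) =
      (n.+1%:R^-1%:E * P (X @^-1` [set x]))%E].
  have : P (X @^-1` [set x]) \is a fin_num by exact: fin_num_measure.
  have : (0 <= P (X @^-1` [set x]))%E by exact: measure_ge0.
  case PE : (P (X @^-1` [set x])) => [p| |]// p0 _; rewrite lee_fin in p0.
  have c0 : 0 <= n.+1%:R^-1 * p by rewrite mulr_ge0// invr_ge0.
  have [|h [[_ mh] hn Ph]] := measurable_split (n := n) (mX [set x]) (fun=> c0).
    rewrite PE sumr_const card_ord; congr (_%:E).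
    by rewrite -[RHS]mulr_natl mulrA divff ?mul1r// pnatr_eq0.
  by exists h; split=> // j jn; rewrite Ph// EFinM.
exists (fun w => g (X w) w); split=> [|w|x j jn].
- split=> [|S].
    apply: (@sub_finite_set _ _ `I_n.+1) => // _ [w _ <-] /=.
    by have [_ gn _] := gP (X w); exact: gn.
  rewrite (_ : _ @^-1` S =
      \bigcup_(x in range X) (X @^-1` [set x] `&` g x @^-1` S)).
    apply: fin_bigcup_measurable => // x _; apply: measurableI => //.
    by have [] := gP x.
  apply/seteqP; split=> [w Sw|w [x _ [/= -> //]]].
  by exists (X w).
- by have [_ gn _] := gP (X w); exact: gn.
- have [_ _ /(_ j jn) <-] := gP x; congr (P _).
  by apply/seteqP; split=> w [/= Xw] gw; split=> //=; move: gw; rewrite Xw.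
Qed.

(** Copies a finitely supported law onto [W] by splitting [W] in the proportions of the atoms of
    [Y]. *)
Lemma discrete_transfer {dV} {V : measurableType dV} (Q : probability V R)
    (T : choiceType) (x0 : T) (Y : V -> T) : discrete Y ->
  exists X : W -> T, [/\ discrete X, range X `<=` x0 |` range Y &
    forall S, P (X @^-1` S) = Q (Y @^-1` S)].
Proof.
move=> [fY mY]; have /finite_seqP[s sE] := fY.
pose n := size s; pose k v := index (Y v) s; pose y j := nth x0 s j.
have Ys v : Y v \in s.
  have : range Y (Y v) by exists v.
  by rewrite sE.
have yk v : y (k v) = Y v by rewrite /y nth_index.
have kn v : (k v <= n)%N by exact: index_size.
have mk S : measurable (k @^-1` S) by exact: (mY [set x | S (index x s)]).
have fI : finite_set `I_n.+1 by exact: finite_II.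
have dk : discrete k.
  by split=> //; apply: sub_finite_set fI => _ [v _ <-]; exact: kn.
pose c j := fine (Q (k @^-1` [set j])).
have cE j : Q (k @^-1` [set j]) = (c j)%:E by rewrite /c fineK ?fin_num_measure.
have c0 j : 0 <= c j by rewrite /c fine_ge0.
have [|h [dh hn Ph]] := measurable_split (n := n) (A := setT) measurableT c0.
  rewrite probability_setT -(probability_setT Q).
  rewrite (measure_discrete Q dk measurableT fI); last by move=> _ [v _ <-]; exact: kn.
  by rewrite -fsbig_ord -sumEFin; apply: eq_bigr => j _; rewrite setIT cE.
exists (y \o h); split=> [|_ [w _ <-]|S].
- exact: (discrete_comp2 (fun a _ => y a) dh dh).
- rewrite /y/=; have [hs|hs] := ltnP (h w) n; last by left; rewrite nth_default.
  have : [set` s] (nth x0 s (h w)) by exact: mem_nth.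
  by rewrite -sE; right.
- have mX : measurable ((y \o h) @^-1` S) by exact: (dh.2 (y @^-1` S)).
  rewrite (measure_discrete P dh mX fI); last by move=> _ [w _ <-]; exact: hn.
  rewrite (measure_discrete Q dk (mY S) fI); last by move=> _ [v _ <-]; exact: kn.
  apply: eq_fsbigr => j /set_mem jn; have [Sj|Sj] := pselect (S (y j)).
    transitivity (c j)%:E; last rewrite -cE; first rewrite -(Ph j jn).
      congr (P _); apply/seteqP; split=> w /= []; first by move=> -> _.
      by move=> _ ->.
    by congr (Q _); apply/seteqP; split=> v /=; [move=> kj; rewrite kj -yk kj|case].
  rewrite (_ : _ `&` _ = set0); last first.
    by apply/seteqP; split=> // w /= [hj]; rewrite hj.
  rewrite (_ : k @^-1` [set j] `&` _ = set0) ?measure0//.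
  by apply/seteqP; split=> // v /= [kj]; rewrite -yk kj.
Qed.

End Splitting.

(** * The Baire property *)

Section Baire.
Variables (R : realType) (d : nat).
Local Notation BR := (BorelRd R d).
Local Notation PR := (probability BR R).
Variable K : set 'rV[R]_d.
Hypothesis cK : compact K.
Context {dW : measure_display} {W : measurableType dW}.
Variable P : probability W R.
Hypothesis divP : divisible P.
Local Notation law Y := (distribution P Y : PR).
Implicit Types (X Y Z : {mfun W >-> BR}) (U V : set PR).

Lemma compact_eball_cover r : 0 < r -> exists s : seq 'rV[R]_d,
  (forall x, x \in s -> K x) /\ (forall x, K x -> has (fun y => edist y x < r) s).
Proof.
move=> r0; move: (cK); rewrite compact_cover => /(_ _ K (fun y => eball y r)).
move=> []; first by move=> y _; exact: open_eball.
  by move=> x Kx; exists x => //; exact: eball_center.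
move=> D DK KD; exists (enum_fset D); split=> [x xD|x /KD[y /= yD xy]].
  by apply/set_mem/DK.
by apply/hasP; exists y.
Qed.

Lemma discrete_mfun {dV} {V : measurableType dV} (Y : V -> 'rV[R]_d) : discrete Y ->
  exists2 Z : {mfun V >-> BR}, discrete (Z : V -> 'rV[R]_d) & forall v, Z v = Y v.
Proof.
move=> dY; have [_ mY] := dY; have fY : measurable_fun [set: V] (Y : V -> BR).
  by move=> _ S mS; rewrite setTI; exact: mY.
by exists (mfun_Sub (mem_set fY)).
Qed.

Definition simple_in X := discrete (X : W -> 'rV[R]_d) /\ forall w, K (X w).

(* A form of density in which the perturbation is a coupling: the variables
   produced by successive steps converge almost surely, so that the Baire argument
   has a limit law without appealing to the compactness of [PK K]. *)
Definition approachable U := forall X (e : R), simple_in X -> 0 < e ->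
  exists Y (E : set W), [/\ simple_in Y, measurable E, (P E <= e%:E)%E,
    forall w, ~ E w -> edist (X w) (Y w) <= e & U (law Y)].

(** [Z] need not be simple, since this is applied to the limit variable. *)
Definition robust U X (e : R) := forall Z (E : set W), measurable E ->
  (P E <= e%:E)%E -> (forall w, K (Z w)) ->
  (forall w, ~ E w -> edist (X w) (Z w) <= e) -> U (law Z).

Lemma law_PK X : (forall w, K (X w)) -> PK K (law X).
Proof.
move=> KX; rewrite /PK/= /distribution /pushforward.
rewrite (_ : _ @^-1` K = setT); first exact: probability_setT.
by apply/seteqP; split=> w // _; exact: KX.
Qed.

Lemma weak_open_robust U X : weak_open K U -> (forall w, K (X w)) -> U (law X) ->
  exists2 e : R, 0 < e & robust U X e.
Proof.
move=> [_ oU] KX /oU[n [f [e [cf e0 feU]]]].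
have /choice[eta etaP] i : exists eta : R, 0 < eta /\
    forall Y Z (E : set W), measurable E -> (P E <= eta%:E)%E ->
    (forall w, ~ E w -> [/\ K (Y w), K (Z w) & edist (Y w) (Z w) <= eta]) ->
    (`|\int[distribution P Y]_(x in K) (f i x)%:E -
       \int[distribution P Z]_(x in K) (f i x)%:E| < e%:E)%E.
  by have [r r0 rP] := law_close P cK (cf i) e0; exists r.
have [r r0 reta] := finite_lower_bound (fun i => (etaP i).1).
exists r => // Z E mE PE KZ XZ; apply: feU; split=> [|i]; first exact: law_PK.
apply: ((etaP i).2 Z X E mE) => [|w nEw].
  by apply: le_trans PE _; rewrite lee_fin.
by split=> //; rewrite edistC; apply: le_trans (XZ _ nEw) _.
Qed.

(** The measure [mu] is the law of the identity on [BR]. Rounding the identity to a finite net of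
    [K] gives a nearby finitely supported law, which is then copied onto [W]. *)
Lemma weak_open_simple V : weak_open K V -> V !=set0 ->
  exists2 X, simple_in X & V (law X).
Proof.
move=> [VK oV] [mu Vmu]; have [n [f [e [cf e0 feV]]]] := oV mu Vmu.
have muK := VK _ Vmu; have mK : measurable (K : set BR) by exact: measurable_compact.
have /choice[eta etaP] i : exists eta : R, 0 < eta /\
    forall (Y Z : {mfun BR >-> BR}) (E : set BR), measurable E ->
    (mu E <= eta%:E)%E ->
    (forall w, ~ E w -> [/\ K (Y w), K (Z w) & edist (Y w) (Z w) <= eta]) ->
    (`|\int[distribution mu Y]_(x in K) (f i x)%:E -
       \int[distribution mu Z]_(x in K) (f i x)%:E| < e%:E)%E.
  by have [r r0 rP] := law_close mu cK (cf i) e0; exists r.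
have [r r0 reta] := finite_lower_bound (fun i => (etaP i).1).
have [s [sK Ks]] := compact_eball_cover r0.
have [x0 Kx0] : K !=set0.
  apply/set0P/eqP => K0; move: muK; rewrite /PK/= K0 measure0 => /eqP.
  by rewrite eq_sym onee_eq0.
(* [g s x] is the first net point within [r] of [x], and [x0] if there is none, which happens only
   off [K]. *)
pose fix g t x {struct t} := if t is c :: t' then
  if x \in eball c r then c else g t' x else x0.
have dg t : discrete (g t : BR -> 'rV[R]_d).
  elim: t => [|c t IH]; first exact: discrete_cst.
  by apply: discrete_if => //; [exact: measurable_eball|exact: discrete_cst].
have gs t x : (forall y, y \in t -> K y) -> K (g t x).
  elim: t => [//|c t IH] tK /=; case: ifP => _.
    by apply: tK; rewrite mem_head.
  by apply: IH => y yt; apply: tK; rewrite in_cons yt orbT.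
have gr t x : has (fun y => edist y x < r) t -> edist x (g t x) <= r.
  elim: t => [//|c t IH] /=; case: ifPn => [/set_mem xc _|xc].
    by rewrite edistC ltW.
  move=> /orP[cx|/IH//]; by move: xc; rewrite notin_setE.
have [G _ GE] := discrete_mfun (dg s).
have [X0 [dX0 X0s PX0]] := discrete_transfer divP mu x0 (dg s).
have [X dX XE] := discrete_mfun dX0.
have KX w : K (X w).
  have : range X0 (X0 w) by exists w.
  by move=> /X0s; rewrite XE => -[->//|[x _ <-]]; exact: gs.
exists X; first by split.
apply: feV; split=> [|i]; first exact: law_PK.
have -> : (\int[distribution P X]_(x in K) (f i x)%:E =
          \int[distribution mu G]_(x in K) (f i x)%:E)%E.
  apply: eq_measure_integral => A mA _.
  transitivity (P (X0 @^-1` A)).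
    by congr (P _); apply/seteqP; split=> w; rewrite /= XE.
  by rewrite PX0; congr (mu _); apply/seteqP; split=> w; rewrite /= GE.
have mid : measurable_fun [set: BR] (@id BR) by exact: measurable_id.
have -> : (\int[mu]_(x in K) (f i x)%:E =
    \int[distribution mu (mfun_Sub (mem_set mid))]_(x in K) (f i x)%:E)%E.
  by apply: eq_measure_integral.
apply: ((etaP i).2 G _ (~` K)) => [||x /contrapT Kx].
- exact: measurableC.
- by rewrite probability_setC// muK subee// lee_fin ltW// (etaP i).1.
- split=> //; first by rewrite GE; exact: gs.
  by rewrite GE edistC; apply: le_trans (reta i); apply: gr; exact: Ks.
Qed.

(** Off [F n], membership of [Z] in an open set can be certified by [X n], once a ball around [X n]
    known to contain [Z] fits in the open set. *)
Lemma weak_limit_measurable (X : nat -> W -> 'rV[R]_d) (F : nat -> set W)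
    (eta : nat -> R) (Z : W -> 'rV[R]_d) :
  (forall n, discrete (X n)) -> (forall n, measurable (F n)) ->
  (forall n, F n.+1 `<=` F n) ->
  (forall e, 0 < e -> forall n, exists2 m, (n <= m)%N & eta m < e) ->
  (forall n, 0 < eta n) ->
  (forall n w, ~ F n w -> edist (X n w) (Z w) <= eta n) ->
  (forall w, (forall n, F n w) -> Z w = X 0%N w) ->
  measurable_fun [set: W] (Z : W -> BR).
Proof.
move=> dX mF Fdecr eta0 etagt0 XZ ZX.
apply: (@measurability _ _ W BR setT Z (@open 'rV[R]_d) erefl) => _ [A oA <-].
(* Radius [2 * eta n] turns the bound [edist (X n w) (Z w) <= eta n] into strict membership. That
   ball fits in [A] once [3 * eta n] is less than the radius of a ball around [Z w] inside [A]. *)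
rewrite setTI (_ : _ @^-1` A = ((\bigcap_n F n) `&` X 0%N @^-1` A) `|`
  \bigcup_n (~` F n `&` X n @^-1` [set x | eball x (2 * eta n) `<=` A])).
  apply: measurableU.
    apply: measurableI; last exact: (dX 0%N).2.
    by apply: bigcapT_measurable.
  apply: bigcupT_measurable => n; apply: measurableI; last exact: (dX n).2.
  exact: measurableC.
apply/seteqP; split=> [w AZ|w [[Fw ZA]|[n _ [nFw nA]]]] /=.
- have [Fw|/existsNP[n nFw]] := pselect (forall n, F n w).
    by left; split=> [n _//|]; rewrite /= -(ZX _ Fw).
  right; have [r r0 rA] : exists2 r : R, 0 < r & eball (Z w) r `<=` A.
    by apply/nbhs_eballP; apply: open_nbhs_nbhs.
  have [m nm etam] := eta0 _ (divr_gt0 r0 (ltr0n R 3)) n.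
  have nFm : ~ F m w.
    move: nm nFw => /subnKC <-; elim: (m - n)%N => [|k IH]; first by rewrite addn0.
    by move=> /IH {}IH /=; rewrite addnS => /Fdecr.
  exists m => //; split=> //=; apply: subset_trans rA; apply: eball_sub.
  by have := XZ _ _ nFm; rewrite edistC; lra.
- by rewrite (ZX w)// => n; exact: Fw.
- apply: nA; rewrite /eball/=.
  by have := XZ _ _ nFw; have := etagt0 n; lra.
Qed.

(** Any cluster point will do: a bound on the distances from [x n] to the later terms passes to
    it. *)
Lemma tail_limit (x : nat -> 'rV[R]_d) : (forall n, K (x n)) ->
  exists2 z, K z & forall n r, (forall m, (n <= m)%N -> edist (x n) (x m) <= r) ->
    edist (x n) z <= r.
Proof.
move=> Kx; have [|z [Kz cz]] := cK (F := x @ \oo).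
  by exists 0%N => // n _; exact: Kx.
exists z => // n r xr; apply/ler_addgt0Pr => e e0.
have [|y [[m nm <-] /= zy]] :=
  cz [set x m | m in [set m | (n <= m)%N]] _ _ (nbhs_eball z e0).
  by exists n => // m /= nm; exists m.
apply: le_trans (edist_triangle (x m) _ _) _; apply: lerD; first exact: xr.
by rewrite edistC ltW.
Qed.

(** A Banach-Mazur strategy played with random variables: step [n] moves the current variable into
    [U n], then fixes a tolerance [eta n.+1] within which all later moves together must stay. *)
Theorem approachable_dense (U : nat -> set PR) :
  (forall n, weak_open K (U n)) -> (forall n, approachable (U n)) ->
  weak_dense K (\bigcap_n U n).
Proof.
move=> oU aU; split=> [mu /(_ 0%N I)|V oV V0]; first exact: (oU _).1.
have [X0 sX0 VX0] := weak_open_simple oV V0.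
have [eta0 eta00 rV0] := weak_open_robust oV sX0.2 VX0.
pose St := ({mfun W >-> BR} * R)%type.
pose good (p : St) := simple_in p.1 /\ 0 < p.2.
have /choice[next nextP] (q : nat * St) : exists pE : St * set W, good q.2 ->
    [/\ good pE.1, pE.1.2 <= q.2.2 / 2, robust (U q.1) pE.1.1 pE.1.2,
        measurable pE.2 /\ (P pE.2 <= (q.2.2 / 4)%:E)%E &
        forall w, ~ pE.2 w -> edist (q.2.1 w) (pE.1.1 w) <= q.2.2 / 4].
  case: q => n [X e]; have [gX|ngX] := pselect (good (X, e)); last first.
    by exists (X, e, set0) => /ngX.
  have e4 : 0 < e / 4 by rewrite divr_gt0// gX.2.
  have [Y [E [sY mE PE XY UY]]] := aU n X _ gX.1 e4.
  have [e' e'0 rY] := weak_open_robust (oU n) sY.2 UY.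
  have m0 : 0 < Num.min e' (e / 2) by rewrite lt_min e'0 divr_gt0// gX.2.
  exists (Y, Num.min e' (e / 2), E) => _; split=> //=.
    by rewrite ge_min lexx orbT.
  move=> Z E' mE' PE' KZ YZ; apply: (rY Z E') => //.
    by apply: le_trans PE' _; rewrite lee_fin ge_min lexx.
  by move=> w /YZ/le_trans; apply; rewrite ge_min lexx.
pose s := fix s n : St := if n is n'.+1 then (next (n', s n')).1 else (X0, eta0).
pose E n := (next (n, s n)).2.
pose X n := (s n).1; pose eta n := (s n).2.
have gs n : good (s n).
  by elim: n => [|n IH] //=; have [] := nextP (n, s n) IH.
have eta_gt0 n : 0 < eta n by exact: (gs n).2.
have sX n : simple_in (X n) by exact: (gs n).1.
have eta_half n : eta n.+1 <= eta n / 2 by have [] := nextP (n, s n) (gs n).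
have rU n : robust (U n) (X n.+1) (eta n.+1) by have [] := nextP (n, s n) (gs n).
have mE n : measurable (E n) by have [_ _ _ []] := nextP (n, s n) (gs n).
have PE n : (P (E n) <= (eta n / 4)%:E)%E by have [_ _ _ []] := nextP (n, s n) (gs n).
have XE n w : ~ E n w -> edist (X n w) (X n.+1 w) <= eta n / 4.
  by have [_ _ _ _] := nextP (n, s n) (gs n); exact.
have eta_geo n k : eta (n + k)%N <= eta n / (2 ^ k)%:R.
  elim: k => [|k IH]; first by rewrite addn0 expn0 divr1.
  rewrite addnS; apply: le_trans (eta_half _) _.
  by rewrite expnSr natrM invfM mulrA ler_pM2r// invr_gt0.
(* The tolerances at least halve and each step spends a quarter of its own. So the moves from step
   [n] on spend at most [eta n / 2], both in probability (that of [F n]) and, off [F n], in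
   distance. *)
pose F n := \bigcup_k E (n + k)%N.
have mF n : measurable (F n) by exact: bigcupT_measurable.
have Fdecr n : F n.+1 `<=` F n.
  by move=> w [k _]; rewrite addSnnS => Ew; exists k.+1.
have PF n : (P (F n) <= (eta n)%:E)%E.
  apply: le_trans (measure_sigma_subadditive _ _ _ (@subset_refl _ (F n))) _ => //.
  apply: (@le_trans _ _ (\sum_(0 <= k <oo) ((eta n / 2) / (2 ^ k.+1)%:R)%:E)%E).
    apply: lee_nneseries => [k _ _|k _]; first exact: measure_ge0.
    apply: le_trans (PE _) _; rewrite lee_fin.
    have := eta_geo n k; rewrite -(ler_pM2r (_ : 0 < 4^-1 :> R))// => /le_trans; apply.
    rewrite expnS natrM le_eqVlt; apply/orP; left; apply/eqP; field.
    by rewrite pnatr_eq0 expn_eq0.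
  apply: le_trans (epsilon_trick0 _ _) _; first by rewrite divr_ge0// ltW.
  by rewrite lee_fin ler_pdivrMr// ler_peMr ?ler1n// ltW.
have XF n w : ~ F n w -> forall m, (n <= m)%N -> edist (X n w) (X m w) <= eta n.
  move=> nF m /subnKC <-; apply: (@le_trans _ _ (eta n / 2)); last first.
    by rewrite ler_pdivrMr// ler_peMr ?ler1n// ltW.
  move: (m - n)%N => k; elim: k n nF => [n _|k IH n nF].
    by rewrite addn0 edistxx divr_ge0// ltW.
  have := IH n.+1 (fun Fw => nF (Fdecr _ _ Fw)); rewrite addSnnS => IHn.
  have nE : ~ E n w by move=> En; apply: nF; exists 0%N => //; rewrite addn0.
  have := edist_triangle (X n.+1 w) (X n w) (X (n + k.+1)%N w).
  by have := XE _ _ nE; have := eta_half n; lra.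
(* On the null set where every [F n] occurs, [Z] is set to [X 0] to keep it measurable and in
   [K]. *)
have /choice[Z ZP] w : exists z, [/\ K z,
    forall n, ~ F n w -> edist (X n w) z <= eta n &
    (forall n, F n w) -> z = X 0%N w].
  have [Fw|nFw] := pselect (forall n, F n w).
    by exists (X 0%N w); split=> //; exact: (sX _).2.
  have [z Kz zP] := @tail_limit (X ^~ w) (fun n => (sX n).2 w).
  by exists z; split=> // n nF; apply: zP; exact: XF.
have eta_small e : 0 < e -> forall n, exists2 m, (n <= m)%N & eta m < e.
  move=> e0 n; have [k _ ke] := near_infty_natSinv_lt (PosNum (divr_gt0 e0 (eta_gt0 n))).
  exists (n + k)%N; first exact: leq_addr.
  apply: le_lt_trans (eta_geo n k) _.
  apply: (@le_lt_trans _ _ (eta n / k.+1%:R)).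
    rewrite ler_pM2l// lef_pV2 ?posrE ?ltr0n ?expn_gt0// ler_nat.
    exact: ltn_expl.
  by have := ke k (leqnn k); rewrite /= ltr_pdivlMr// mulrC.
have mZ : measurable_fun [set: W] (Z : W -> BR).
  apply: (weak_limit_measurable (X := fun n => X n) (F := F) (eta := eta)) => //.
  - by move=> n; exact: (sX n).1.
  - by move=> n w; have [_ + _] := ZP w; exact.
  - by move=> w; have [_ _] := ZP w; exact.
pose Zm : {mfun W >-> BR} := mfun_Sub (mem_set mZ).
have KZ w : K (Zm w) by have [] := ZP w.
have XZ n w : ~ F n w -> edist (X n w) (Zm w) <= eta n by have [_ + _] := ZP w; exact.
exists (law Zm); split=> [|n _].
  exact: (rV0 Zm (F 0%N) (mF _) (PF _) KZ (XZ _)).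
exact: (rU n Zm (F n.+1) (mF _) (PF _) KZ (XZ _)).
Qed.

End Baire.

(** * Logarithmic limits and covering numbers *)

Section LogLimits.
Variable R : realType.
Implicit Types (phi : R -> \bar R) (a b v : \bar R) (r c : R).

(** As [ln r < 0], a lower bound on a mass bounds the dimension ratio from above; the next lemma is
    the reverse. *)
Lemma elog_ratio_le v r c : 0 < r < 1 -> 0 < c -> (c%:E <= v)%E ->
  (elog v * ((ln r)^-1)%:E <= (ln c / ln r)%:E)%E.
Proof.
move=> r01 c0; have lnr : ln r < 0 by exact: ln_lt0.
case: v => [x| |]//=; rewrite ?lee_fin => cx.
- have x0 : 0 < x by exact: lt_le_trans cx.
  by rewrite x0 -EFinM lee_fin ler_nM2r ?invr_lt0// ler_ln.
- by rewrite lt0_mulye ?leNye// lte_fin invr_lt0.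
Qed.

Lemma elog_ratio_ge v r c : 0 < r < 1 -> 0 < c -> (v <= c%:E)%E ->
  ((ln c / ln r)%:E <= elog v * ((ln r)^-1)%:E)%E.
Proof.
move=> r01 c0; have lnr : ln r < 0 by exact: ln_lt0.
have lnr' : ((ln r)^-1%:E < 0)%E by rewrite lte_fin invr_lt0.
case: v => [x| |]//=; rewrite ?lee_fin => cx; last by rewrite lt0_mulNye ?leey.
case: ifP => [x0|_]; last by rewrite lt0_mulNye ?leey.
by rewrite -EFinM lee_fin ler_nM2r ?invr_lt0// ler_ln.
Qed.

(** Absorbs every constant: [C] collects logarithms of multiplicative losses, and [h] is the slack
    left in the exponent. *)
Lemma small_ln_bound (C h : R) : 0 < h ->
  exists2 dl : R, 0 < dl <= 1 & forall r, 0 < r < dl -> C <= h * - ln r.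
Proof.
move=> h0; exists (Num.min 1 (expR (- C / h))).
  by rewrite lt_min ltr01 expR_gt0/= ge_min lexx.
move=> r /andP[r0]; rewrite lt_min => /andP[_ rC].
have : ln r <= - C / h by rewrite -[leRHS]expRK ler_ln ?posrE ?expR_gt0// ltW.
by rewrite ler_pdivlMr// => ?; lra.
Qed.

Lemma le_elimsup0 phi a :
  (forall dl : R, 0 < dl -> exists2 r, 0 < r < dl & (a <= phi r)%E) ->
  (a <= elimsup0 phi)%E.
Proof.
move=> aphi; apply/ereal_infP => _ [dl /= dl0 <-].
have [r rdl ar] := aphi _ dl0.
by apply: le_ereal_sup_tmp; exists (phi r) => //; exists r.
Qed.

Lemma elimsup0_le phi a dl : 0 < dl -> (forall r, 0 < r < dl -> (phi r <= a)%E) ->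
  (elimsup0 phi <= a)%E.
Proof.
move=> dl0 aphi; apply: ge_ereal_inf.
exists (ereal_sup [set phi r | r in [set r | 0 < r < dl]]); first by exists dl.
by apply/ereal_supP => _ [r /= rdl <-]; exact: aphi.
Qed.

Lemma lt_elimsup0 phi a dl : (a < elimsup0 phi)%E -> 0 < dl ->
  exists2 r, 0 < r < dl & (a < phi r)%E.
Proof.
move=> + dl0; rewrite ltNge => /negP aphi; apply: contrapT => naphi.
apply: aphi; apply: (elimsup0_le dl0) => r rdl.
by rewrite leNgt; apply/negP => ar; apply: naphi; exists r.
Qed.

Lemma elimsup0_lt phi a : (elimsup0 phi < a)%E ->
  exists2 dl : R, 0 < dl & forall r, 0 < r < dl -> (phi r < a)%E.
Proof.
move=> /ereal_inf_lt[_ [dl /= dl0 <-]] supa; exists dl => // r rdl.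
by apply: le_lt_trans supa; apply: le_ereal_sup_tmp; exists (phi r) => //; exists r.
Qed.

Lemma le_eliminf0 phi a dl : 0 < dl -> (forall r, 0 < r < dl -> (a <= phi r)%E) ->
  (a <= eliminf0 phi)%E.
Proof.
move=> dl0 aphi; apply: le_ereal_sup_tmp.
exists (ereal_inf [set phi r | r in [set r | 0 < r < dl]]); first by exists dl.
by apply/ereal_infP => _ [r /= rdl <-]; exact: aphi.
Qed.

Lemma eliminf0_le phi a :
  (forall dl : R, 0 < dl -> exists2 r, 0 < r < dl & (phi r <= a)%E) ->
  (eliminf0 phi <= a)%E.
Proof.
move=> aphi; apply/ereal_supP => _ [dl /= dl0 <-].
have [r rdl ar] := aphi _ dl0.
by apply: ge_ereal_inf; exists (phi r) => //; exists r.
Qed.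

Lemma eliminf0_lt phi a dl : (eliminf0 phi < a)%E -> 0 < dl ->
  exists2 r, 0 < r < dl & (phi r < a)%E.
Proof.
move=> + dl0; rewrite ltNge => /negP aphi; apply: contrapT => naphi.
apply: aphi; apply: (le_eliminf0 dl0) => r rdl.
by rewrite leNgt; apply/negP => ar; apply: naphi; exists r.
Qed.

Lemma lt_eliminf0 phi a : (a < eliminf0 phi)%E ->
  exists2 dl : R, 0 < dl & forall r, 0 < r < dl -> (a < phi r)%E.
Proof.
move=> /ereal_sup_gt[_ [dl /= dl0 <-]] ainf; exists dl => // r rdl.
by apply: lt_le_trans ainf _; apply: ge_ereal_inf; exists (phi r) => //; exists r.
Qed.

Lemma ereal_lt_between a b : (a < b)%E -> exists2 c : R, (a < c%:E)%E & (c%:E < b)%E.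
Proof.
case: a b => [a| |] [b| |]//; rewrite ?lte_fin => ab.
- by exists ((a + b) / 2); rewrite lte_fin; lra.
- by exists (a + 1); rewrite ?ltry// lte_fin; lra.
- by exists (b - 1); rewrite ?ltNyr// lte_fin; lra.
- by exists 0; rewrite ?ltNyr ?ltry.
Qed.

Lemma lee_lt_fin a b : (forall c : R, (c%:E < a)%E -> (c%:E <= b)%E) -> (a <= b)%E.
Proof.
move=> ab; rewrite leNgt; apply/negP => /ereal_lt_between[c bc /ab].
by rewrite leNgt bc.
Qed.

Lemma lee_gt_fin a b : (forall c : R, (b < c%:E)%E -> (a <= c%:E)%E) -> (a <= b)%E.
Proof.
move=> ab; rewrite leNgt; apply/negP => /ereal_lt_between[c /ab].
by rewrite leNgt => /negP.
Qed.

Lemma inv_nat_lt (e : R) : 0 < e -> exists n : nat,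
  forall m, (n <= m)%N -> m.+1%:R^-1 < e :> R.
Proof.
by move=> e0; have [n _ nP] := near_infty_natSinv_lt (PosNum e0); exists n.
Qed.

(* Strictly increasing to [a] when [0 <= a]; the value at [-oo] is junk. *)
Definition below (a : \bar R) (n : nat) : R :=
  if a is x%:E then x - n.+1%:R^-1 else n%:R.

Lemma below_incr a m n : (m < n)%N -> below a m < below a n.
Proof.
move=> mn; case: a => [x| |]; rewrite /= ?ltr_nat//.
by rewrite ltrD2l ltrN2 ltf_pV2 ?posrE// ltr_nat.
Qed.

Lemma below_lt a n : (0 <= a)%E -> ((below a n)%:E < a)%E.
Proof.
by case: a => [x| |]//= _; rewrite ?ltry// lte_fin ltrBlDr ltrDl invr_gt0.
Qed.

Lemma below_le a b : (0 <= a)%E -> (forall n, (below a n)%:E <= b)%E -> (a <= b)%E.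
Proof.
move=> a0 ab; apply: lee_lt_fin => c.
case: a a0 ab => [x| |]//= _ ab ca.
- rewrite lte_fin in ca; have [n nP] := inv_nat_lt (etrans (subr_gt0 c x) ca).
  apply: le_trans (ab n); rewrite lee_fin lerBrDr -lerBrDl.
  exact/ltW/nP.
- apply: le_trans (ab (Num.truncn c).+1); rewrite lee_fin.
  exact/ltW/truncnS_gt.
Qed.

End LogLimits.

Section Covering.
Variables (R : realType) (d : nat).
Implicit Types (E K : set 'rV[R]_d) (r : R).

Lemma compact_finite_cover K E r : compact K -> E `<=` K -> 0 < r ->
  exists (n : nat) (c : 'I_n -> 'rV[R]_d),
    E `<=` \bigcup_(i in [set: 'I_n]) eball (c i) r.
Proof.
move=> cK EK r0; have [s [_ Ks]] := compact_eball_cover cK r0.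
exists (size s), (fun i => nth 0 s i) => x /EK /Ks/hasP[y ys yx].
have ys' : (index y s < size s)%N by rewrite index_mem.
by exists (Ordinal ys') => //=; rewrite nth_index.
Qed.

Lemma Ncov_attained E r :
  (exists (n : nat) (c : 'I_n -> 'rV[R]_d),
    E `<=` \bigcup_(i in [set: 'I_n]) eball (c i) r) ->
  exists (n : nat) (c : 'I_n -> 'rV[R]_d),
    E `<=` \bigcup_(i in [set: 'I_n]) eball (c i) r /\ Ncov E r = n%:R%:E.
Proof.
move=> [n0 covn0].
pose Q n := `[< exists c : 'I_n -> 'rV[R]_d,
  E `<=` \bigcup_(i in [set: 'I_n]) eball (c i) r >].
have exQ : exists n, Q n by exists n0; apply/asboolP.
have [n /asboolP[c covn] nmin] := ex_minnP exQ.
exists n, c; split=> //; apply/eqP; rewrite eq_le; apply/andP; split.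
  by apply: ge_ereal_inf; exists n%:R%:E => //; exists n => //; exists c.
apply/ereal_infP => _ [m covm <-]; rewrite lee_fin ler_nat; apply: nmin.
exact/asboolP.
Qed.

Lemma Ncov_le E r n (c : 'I_n -> 'rV[R]_d) :
  E `<=` \bigcup_(i in [set: 'I_n]) eball (c i) r -> (Ncov E r <= n%:R%:E)%E.
Proof.
by move=> Ec; apply: ge_ereal_inf; exists n%:R%:E => //; exists n => //; exists c.
Qed.

Lemma Ncov_ge1 E r : E !=set0 -> (1 <= Ncov E r)%E.
Proof.
move=> [x Ex]; apply/ereal_infP => _ [n [c Ec] <-].
have [i _ _] := Ec _ Ex; rewrite lee_fin ler1n.
exact: leq_ltn_trans (ltn_ord i).
Qed.

Lemma box_ratio_ge0 E r : E !=set0 -> 0 < r < 1 -> (0 <= box_ratio E r)%E.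
Proof.
move=> E0 r01; have N1 := Ncov_ge1 r E0; have lnr := ln_lt0 r01.
rewrite /box_ratio mule_ge0//; last by rewrite lee_fin invr_ge0 oppr_ge0 ltW.
case: (Ncov E r) N1 => [x| |]//=; rewrite lee_fin => x1.
by rewrite (lt_le_trans ltr01 x1) lee_fin ln_ge0.
Qed.

(** Greedy choice: if no point of [E] could be added, the balls around the points already chosen
    would cover [E], with fewer of them than [Ncov E r]. *)
Lemma separated_exists E r n : ((n%:R)%:E <= Ncov E r)%E ->
  exists z : nat -> 'rV[R]_d, (forall i, (i < n)%N -> E (z i)) /\
    forall i j, (i < j < n)%N -> r <= edist (z i) (z j).
Proof.
elim: n => [_|n IH nE]; first by exists (fun=> 0); split=> // i j /andP[].
have [|z [Ez zz]] := IH; first by apply: le_trans nE; rewrite lee_fin ler_nat.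
have [x Ex xz] : exists2 x, E x & forall i, (i < n)%N -> r <= edist (z i) x.
  apply: contrapT => nx.
  suff /Ncov_le : E `<=` \bigcup_(i in [set: 'I_n]) eball (z i) r.
    by move=> /(le_trans nE); rewrite lee_fin ler_nat ltnn.
  move=> x Ex; apply: contrapT => nxz; apply: nx; exists x => // i ni.
  by rewrite leNgt; apply/negP => zx; apply: nxz; exists (Ordinal ni).
exists (fun i => if (i < n)%N then z i else x); split=> [i _|i j /andP[ij]].
  by case: ifP => // /Ez.
rewrite ltnS leq_eqVlt => /predU1P[jn|jn].
  by rewrite jn ltnn -{1}jn ij; apply: xz; rewrite -jn.
by rewrite jn (ltn_trans ij jn); apply: zz; rewrite ij.
Qed.

End Covering.

(** * Bounds valid for every measure of full support *)

Section Bounds.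
Variables (R : realType) (d : nat).
Local Notation BR := (BorelRd R d).
Local Notation PR := (probability BR R).
Variable K : set 'rV[R]_d.
Hypothesis cK : compact K.
Implicit Types (mu : PR).

Lemma PK_neq0 mu : PK K mu -> K !=set0.
Proof.
move=> muK; apply/set0P/eqP => K0; move: muK; rewrite /PK/= K0 measure0 => /eqP.
by rewrite eq_sym onee_eq0.
Qed.

Lemma supp_full mu : PK K mu ->
  (forall x r, K x -> 0 < r -> (0 < mu (eball x r))%E) -> supp mu = K.
Proof.
move=> muK mu0; apply/seteqP; split=> x; last by move=> Kx r; exact: mu0.
move=> sx; apply: contrapT => nKx.
have [r r0 rK] : exists2 r : R, 0 < r & eball x r `<=` ~` K.
  apply/nbhs_eballP; apply: open_nbhs_nbhs; split=> //.
  by apply: closed_openC; exact: compact_closed_rV.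
have := sx r r0; rewrite -(PK_setI cK muK (measurable_eball x r)).
rewrite (_ : _ `&` K = set0) ?measure0 ?ltxx//.
by apply/seteqP; split=> // y [/rK].
Qed.

Lemma packing_measure mu n (B : nat -> set BR) : (0 < n)%N ->
  (forall j, measurable (B j)) -> trivIset `I_n B ->
  exists2 j, (j < n)%N & (mu (B j) <= (n%:R^-1)%:E)%E.
Proof.
move=> n0 mB tB; apply: contrapT => nB.
pose b j := fine (mu (B j)).
have bE j : mu (B j) = (b j)%:E by rewrite /b fineK// fin_num_measure.
have bn j : (j < n)%N -> n%:R^-1 < b j.
  move=> jn; rewrite -lte_fin -bE ltNge; apply/negP => bj.
  by apply: nB; exists j.
have mU : measurable (\bigcup_(j in `I_n) B j) by exact: fin_bigcup_measurable.
have : (mu (\bigcup_(j in `I_n) B j) <= 1)%E by exact: probability_le1.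
have -> : mu (\bigcup_(j in `I_n) B j) = (\sum_(0 <= j < n) b j)%:E.
  rewrite measure_fin_bigcup// -fsbig_ord -sumEFin big_mkord.
  by apply: eq_bigr => j _; exact: bE.
rewrite lee_fin leNgt => /negP; apply.
have <- : \sum_(0 <= j < n) n%:R^-1 = 1 :> R.
  by rewrite sumr_const_nat subn0 -[LHS]mulr_natl divff// pnatr_eq0 -lt0n.
by apply: ltr_sum_nat => // j /andP[_ jn]; exact: bn.
Qed.

Lemma covering_measure mu n (B : 'I_n -> set BR) (A : set BR) (q : R) :
  measurable A -> (forall i, measurable (B i)) ->
  A `<=` \bigcup_(i in [set: 'I_n]) B i ->
  (forall i, (mu (B i) <= q%:E)%E) -> (mu A <= (n%:R * q)%:E)%E.
Proof.
move=> mA mB AB Bq.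
have fI : finite_set [set: 'I_n] by exact: finite_finset.
apply: le_trans (content_sub_fsum _ fI _ _ AB) _ => //.
apply: (@le_trans _ _ (\sum_(i \in [set: 'I_n]) q%:E)%E).
  by apply: lee_fsum => // i _; exact: Bq.
rewrite (@fsbigE _ _ _ _ _ (enum 'I_n)) ?enum_uniq//; last first.
  by move=> i _; rewrite mem_enum.
under eq_bigl => i do rewrite in_setT.
by rewrite big_enum/= sumEFin sumr_const card_ord mulr_natl.
Qed.

(** Among [Ncov K (2 * r)] points of [K] at mutual distance at least [2 * r], the [r]-balls are
    disjoint, so one of them has mass at most the inverse of that number. *)
Lemma lower_box_dim_le_Dlow mu : PK K mu -> supp mu = K ->
  (lower_box_dim K <= Dlow_minus mu)%E.
Proof.
move=> muK suppK; apply: lee_lt_fin => a /ereal_lt_between[b ab bK].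
rewrite lte_fin in ab.
have [dl dl0 dlP] := lt_eliminf0 bK.
(* The count is taken at radius [2 * r] and the mass at [r]; the cost [b * ln 2] is paid by the gap
   [b - a]. *)
have [dl' /andP[dl'0 dl'1] dl'P] := small_ln_bound (b * ln 2) (etrans (subr_gt0 _ _) ab).
have m0 : 0 < Num.min (dl / 2) (dl' / 2) by rewrite lt_min !divr_gt0.
apply: (le_eliminf0 m0) => r /andP[r0]; rewrite lt_min => /andP[rdl rdl'].
have r01 : 0 < r < 1 by rewrite r0; lra.
have r20 : 0 < 2 * r by lra.
have r201 : 0 < 2 * r < 1 by rewrite r20; lra.
have lnr := ln_lt0 r01; have lnr2 := ln_lt0 r201.
have [n [c [cov NE]]] := Ncov_attained (compact_finite_cover cK (@subset_refl _ K) r20).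
have n1 : (1 <= n)%N.
  by have := Ncov_ge1 (2 * r) (PK_neq0 muK); rewrite NE lee_fin ler1n.
have n0 : 0 < n%:R :> R by rewrite ltr0n.
have bn : b * - ln (2 * r) < ln n%:R.
  have : (b%:E < box_ratio K (2 * r))%E by apply: dlP; rewrite r20; lra.
  by rewrite /box_ratio NE/= n0 -EFinM lte_fin ltr_pdivlMr// oppr_gt0.
have [|z [Kz zz]] := @separated_exists _ _ K (2 * r) n; first by rewrite NE.
have [||j jn muj] := packing_measure mu (n := n) (B := fun j => eball (z j) r) n1.
- by move=> j; exact: measurable_eball.
- have disj i j x : (i < j < n)%N -> eball (z i) r x -> eball (z j) r x -> False.
    move=> ij; have := zz _ _ ij; rewrite /eball/= => zij zix zjx.
    by have := edist_triangle x (z i) (z j); rewrite (edistC x); lra.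
  move=> i j /= ni nj [x [xi xj]]; apply/eqP/contraT => ij.
  move: ij; rewrite neq_ltn => /orP[ij|ij].
  + by exfalso; apply: (disj i j x) => //; rewrite ij.
  + by exfalso; apply: (disj j i x) => //; rewrite ij.
apply: (@le_trans _ _ (ln n%:R^-1 / ln r)%:E).
  rewrite lee_fin ler_ndivlMr// lnV ?posrE//.
  have r2E : ln (2 * r) = ln 2 + ln r by rewrite lnM ?posrE.
  have := dl'P r; rewrite r0 => /(_ _)/wrap[|]; first by rewrite /=; lra.
  by rewrite r2E in bn; lra.
apply: elog_ratio_ge; rewrite ?invr_gt0//.
apply: ge_ereal_inf; exists (mu (eball (z j) r)) => //.
by exists (z j) => //; rewrite suppK; exact: Kz.
Qed.

(** Finitely many balls around points of the support share a lower mass bound [C]. At each scale the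
    one that is easiest to cover contains, by pigeonhole, a piece of mass at least [C / 2] divided
    by its covering number, whichever ball this is. *)
Lemma Dup_le_upper_box_dim mu : PK K mu -> supp mu = K ->
  (Dup_plus mu <= upper_box_dim_loc_unif K)%E.
Proof.
move=> muK suppK; apply/ereal_infP => _ [N [xs [r0 [N0 Kxs r00 ->]]]].
apply: lee_gt_fin => a /ereal_lt_between[b bv ab]; rewrite lte_fin in ab.
have mK : measurable (K : set BR) by exact: measurable_compact.
have [dl dl0 dlP] := elimsup0_lt bv.
have [C C0 CP] : exists2 C : R, 0 < C & forall i, C <= fine (mu (eball (xs i) r0)).
  apply: finite_lower_bound => i.
  rewrite -lte_fin fineK ?fin_num_measure//; last exact: measurable_eball.
  by have : supp mu (xs i) by [rewrite suppK]; exact.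
have [dl' /andP[dl'0 dl'1] dl'P] :=
  small_ln_bound (a * ln 2 - ln (C / 2)) (etrans (subr_gt0 _ _) ab).
have m0 : 0 < Num.min dl dl' by rewrite lt_min dl0.
(* Covering at half the radius: centres of covering balls may lie off [K], and a ball of radius
   [2 * r] around a point of [K] contains any covering ball through it. *)
apply: (elimsup0_le m0) => r2; set r := r2 / 2.
have -> : r2 = 2 * r by rewrite /r; field.
move=> /andP[r20]; rewrite lt_min => /andP[rdl rdl'].
have rp : 0 < r by lra.
have r01 : 0 < r < 1 by rewrite rp; lra.
have r201 : 0 < 2 * r < 1 by rewrite r20; lra.
have lnr := ln_lt0 r01; have lnr2 := ln_lt0 r201.
have [_ [i _ <-] ib] : exists2 y, [set box_ratio (K `&` eball (xs i) r0) r
    | i in [set: 'I_N]] y & (y < b%:E)%E.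
  by apply: ereal_inf_lt; apply: dlP; rewrite rp; lra.
have [n [c [cov NE]]] := Ncov_attained
  (compact_finite_cover cK (@subIsetl _ K (eball (xs i) r0)) rp).
have n1 : (1 <= n)%N.
  have ne : K `&` eball (xs i) r0 !=set0.
    by exists (xs i); split=> //; exact: eball_center.
  by have := Ncov_ge1 r ne; rewrite NE lee_fin ler1n.
have n0 : 0 < n%:R :> R by rewrite ltr0n.
move: ib; rewrite /box_ratio NE/= n0 -EFinM lte_fin ltr_pdivrMr ?oppr_gt0// => nb.
(* Halving [C] turns the summed bound [C / 2] into a strict contradiction. *)
have [j muj] : exists j, ((C / 2 / n%:R)%:E <= mu (K `&` eball (c j) r))%E.
  apply: contrapT => nj.
  have : (mu (K `&` eball (xs i) r0) <= (n%:R * (C / 2 / n%:R))%:E)%E.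
    apply: (covering_measure (B := fun j => K `&` eball (c j) r)).
    - by apply: measurableI => //; exact: measurable_eball.
    - by move=> j; apply: measurableI => //; exact: measurable_eball.
    - by move=> x Kx; have [j _ cx] := cov x Kx; exists j => //; split=> //; case: Kx.
    - move=> j; apply: ltW; rewrite ltNge; apply/negP => jC.
      by apply: nj; exists j.
  rewrite mulrC divfK ?gt_eqF//.
  rewrite setIC (PK_setI cK muK (measurable_eball _ _)).
  have := CP i; rewrite -lee_fin fineK ?fin_num_measure//; last exact: measurable_eball.
  by move=> /le_trans h /h; rewrite lee_fin; lra.
have q0 : 0 < C / 2 / n%:R by rewrite divr_gt0// divr_gt0.
have [y [Ky cy]] : K `&` eball (c j) r !=set0.
  apply/set0P/eqP => e0; move: muj; rewrite e0 measure0 lee_fin.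
  by rewrite leNgt q0.
apply: (@le_trans _ _ (ln (C / 2 / n%:R) / ln (2 * r))%:E); last first.
  rewrite lee_fin ler_ndivrMr// ln_div ?posrE ?divr_gt0//.
  have r2E : ln (2 * r) = ln 2 + ln r by rewrite lnM ?posrE.
  have := dl'P r; rewrite rp => /(_ _)/wrap[|]; first by rewrite /=; lra.
  by rewrite r2E; lra.
apply: elog_ratio_le => //.
apply: le_ereal_sup_tmp; exists (mu (eball y (2 * r))).
  by exists y => //; rewrite suppK.
apply: le_trans muj _; apply: le_measure; rewrite ?inE.
- by apply: measurableI => //; exact: measurable_eball.
- exact: measurable_eball.
- apply: (@subset_trans _ (eball (c j) r)); first exact: subIsetr.
  by apply: eball_sub; move: cy; rewrite /eball/= edistC; lra.
Qed.

Lemma Dlow_plus_ge0 mu : (0 <= Dlow_plus mu)%E.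
Proof.
apply: (le_eliminf0 (@ltr01 R)) => r r01.
rewrite -[X in (X <= _)%E](_ : (ln 1 / ln r)%:E = 0%E); last by rewrite ln1 mul0r.
apply: elog_ratio_ge => //; apply/ereal_supP => _ [x _ <-].
by apply: probability_le1; exact: measurable_eball.
Qed.

Lemma lower_box_dim_ge0 : K !=set0 -> (0 <= lower_box_dim K)%E.
Proof. by move=> K0; apply: (le_eliminf0 (@ltr01 R)) => r; exact: box_ratio_ge0. Qed.

Lemma upper_box_dim_loc_unif_ge0 : (0 <= upper_box_dim_loc_unif K)%E.
Proof.
apply/ereal_infP => _ [N [xs [r0 [N0 Kxs r00 ->]]]].
apply: le_elimsup0 => dl dl0; exists (Num.min (dl / 2) (1 / 2)).
  by rewrite lt_min gt_min !divr_gt0//=; apply/orP; left; lra.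
apply/ereal_infP => _ [i _ <-]; apply: box_ratio_ge0.
  by exists (xs i); split=> //; exact: eball_center.
by rewrite lt_min gt_min !divr_gt0//=; apply/orP; right; lra.
Qed.

End Bounds.

(** * The typical conditions *)

Section Requirements.
Variables (R : realType) (d : nat).
Local Notation BR := (BorelRd R d).
Local Notation PR := (probability BR R).
Variable K : set 'rV[R]_d.
Hypothesis cK : compact K.
Implicit Types (mu nu : PR) (s : seq 'rV[R]_d) (r c : R).
Local Notation inv m := (m.+1%:R^-1 : R).

(** The scale and the threshold are quantified existentially under an arbitrary [D]: a union of
    weakly open sets, so weakly open whatever [D] is. *)
Definition tents_gt (D : seq 'rV[R]_d -> R -> R -> Prop) : set PR :=
  [set nu | exists s r c, [/\ D s r c, 0 < r & PK K nu /\ forall z, z \in s ->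
    (c%:E < \int[nu]_(x in K) (tent z r x)%:E)%E]].

Definition tents_lt (D : seq 'rV[R]_d -> R -> R -> Prop) : set PR :=
  [set nu | exists s r c, [/\ D s r c, 0 < r & PK K nu /\ forall z, z \in s ->
    (\int[nu]_(x in K) (tent z r x)%:E < c%:E)%E]].

Lemma weak_open_tents_gt D : weak_open K (tents_gt D).
Proof.
pose U (q : seq 'rV[R]_d * R * R) : set PR := [set nu | PK K nu /\
  forall i : 'I_(size q.1.1),
    (q.2%:E < \int[nu]_(x in K) (tent (nth 0%R q.1.1 i) q.1.2 x)%:E)%E].
have -> : tents_gt D = \bigcup_(q in [set q | D q.1.1 q.1.2 q.2 /\ 0 < q.1.2]) U q.
  apply/seteqP; split=> nu.
    move=> [s [r [c [Dsrc r0 [nuK nus]]]]]; exists (s, r, c) => //; split=> // i.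
    by apply: nus; apply: mem_nth.
  move=> [[[s r] c] /= [Dsrc r0] [nuK nus]]; exists s, r, c; split=> //; split=> // z zs.
  have zs' : (index z s < size s)%N by rewrite index_mem.
  by have := nus (Ordinal zs'); rewrite /= nth_index.
apply: weak_open_bigcup => q [_ q0].
exact: (weak_open_tent_gt cK _ (fun=> q.2) q0).
Qed.

Lemma weak_open_tents_lt D : weak_open K (tents_lt D).
Proof.
pose U (q : seq 'rV[R]_d * R * R) : set PR := [set nu | PK K nu /\
  forall i : 'I_(size q.1.1),
    (\int[nu]_(x in K) (tent (nth 0%R q.1.1 i) q.1.2 x)%:E < q.2%:E)%E].
have -> : tents_lt D = \bigcup_(q in [set q | D q.1.1 q.1.2 q.2 /\ 0 < q.1.2]) U q.
  apply/seteqP; split=> nu.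
    move=> [s [r [c [Dsrc r0 [nuK nus]]]]]; exists (s, r, c) => //; split=> // i.
    by apply: nus; apply: mem_nth.
  move=> [[[s r] c] /= [Dsrc r0] [nuK nus]]; exists s, r, c; split=> //; split=> // z zs.
  have zs' : (index z s < size s)%N by rewrite index_mem.
  by have := nus (Ordinal zs'); rewrite /= nth_index.
apply: weak_open_bigcup => q [_ q0].
exact: (weak_open_tent_lt cK _ (fun=> q.2) q0).
Qed.

Definition covers s r := forall x, K x -> has (fun y => edist y x < r) s.

(* At a single scale below [1 / (m + 1)], each of the next four conditions forces one
   of the four dimensions up to an error vanishing with [m]. Tents replace indicators
   of balls to make them weakly open; the radii [2 * r], [r / 2], [r / 4] compensate. *)
Definition heavy_ball m := tents_gt (fun s r c =>
  exists2 p, K p & [/\ s = [:: p], r < inv m, 0 < c & ln c / ln r <= inv m]).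

Definition heavy_net m := tents_gt (fun s r c =>
  [/\ covers s r, 2 * r < inv m, 0 < c &
      ((ln c / ln (2 * r))%:E <= lower_box_dim K + (inv m)%:E)%E]).

Definition light_ball m := tents_lt (fun s r c =>
  exists2 p, K p & [/\ s = [:: p], r / 2 < inv m, 0 < c &
    m%:R <= ln (2 * c) / ln (r / 2)]).

Definition light_net m := tents_lt (fun s r c =>
  [/\ covers s (r / 4), r / 4 < inv m, 0 < c &
      below (upper_box_dim_loc_unif K) m <= ln (2 * c) / ln (r / 4)]).

Lemma inv_le1 m : inv m <= 1.
Proof. by rewrite invf_le1// ler1n. Qed.

(** * From the conditions to the dimensions *)

Section Consequences.
Variable mu : PR.
Hypothesis muK : PK K mu.

Lemma heavy_net_ball m : heavy_net m mu -> exists r c, [/\ 0 < r < inv m, 0 < c,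
  ((ln c / ln r)%:E <= lower_box_dim K + (inv m)%:E)%E &
  forall x, K x -> (c%:E <= mu (eball x r))%E].
Proof.
move=> [s [r [c [[sK r2 c0 cr] r0 [_ mus]]]]].
exists (2 * r), c; split=> //; first by rewrite mulr_gt0.
move=> x /sK/hasP[y ys /= yx]; apply: (le_trans (ltW (mus y ys))).
apply: (le_trans (integral_tent_le _ _ muK r0)) => //.
apply: le_measure; rewrite ?inE; try exact: measurable_eball.
by apply: eball_sub; rewrite edistC; lra.
Qed.

Lemma heavy_net_supp : (forall m, heavy_net m mu) -> supp mu = K.
Proof.
move=> hm; apply: supp_full => // x r Kx r0.
have [m mr] := inv_nat_lt r0; have {}mr := mr m (leqnn m).
have [r' [c [/andP[r'0 r'm] c0 _ cK']]] := heavy_net_ball (hm m).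
apply: (@lt_le_trans _ _ c%:E); first by rewrite lte_fin.
apply: (le_trans (cK' x Kx)).
apply: le_measure; rewrite ?inE; try exact: measurable_eball.
by apply: eball_sub; rewrite edistxx add0r ltW// (lt_trans r'm).
Qed.

Hypothesis suppK : supp mu = K.

Lemma heavy_net_Dlow : (forall m, heavy_net m mu) ->
  (Dlow_minus mu <= lower_box_dim K)%E.
Proof.
move=> hm; apply: lee_gt_fin => a.
have := lower_box_dim_ge0 (PK_neq0 muK).
case tE : (lower_box_dim K) => [t| |]//= t0; rewrite lte_fin => ta.
apply: eliminf0_le => dl dl0.
have e0 : 0 < Num.min dl (a - t) by rewrite lt_min dl0 subr_gt0.
have [m mr] := inv_nat_lt e0; have := mr m (leqnn m); rewrite lt_min => /andP[mdl mat].
have [r [c [/andP[r0 rm] c0 cr cK']]] := heavy_net_ball (hm m).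
exists r; first by rewrite r0 (lt_trans rm).
have r01 : 0 < r < 1 by rewrite r0 (lt_le_trans rm)// inv_le1.
apply: (@le_trans _ _ (ln c / ln r)%:E).
  apply: elog_ratio_le => //; apply/ereal_infP => _ [x + <-].
  by rewrite suppK; exact: cK'.
by apply: (le_trans cr); rewrite tE -EFinD lee_fin -lerBrDl ltW.
Qed.

Lemma heavy_ball_Dlow : (forall m, heavy_ball m mu) -> (Dlow_plus mu <= 0)%E.
Proof.
move=> hm; apply: lee_gt_fin => a; rewrite lte_fin => a0.
apply: eliminf0_le => dl dl0.
have e0 : 0 < Num.min dl a by rewrite lt_min dl0.
have [m mr] := inv_nat_lt e0; have := mr m (leqnn m); rewrite lt_min => /andP[mdl ma].
have [s [r [c [[p Kp [sp rm c0 cr]] r0 [_ mus]]]]] := hm m.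
exists r; first by rewrite r0 (lt_trans rm).
have r01 : 0 < r < 1 by rewrite r0 (lt_le_trans rm)// inv_le1.
apply: (@le_trans _ _ (ln c / ln r)%:E); last first.
  by rewrite lee_fin (le_trans cr)// ltW.
apply: elog_ratio_le => //; apply: le_ereal_sup_tmp; exists (mu (eball p r)).
  by exists p => //; rewrite suppK.
have /mus/ltW/le_trans : p \in s by rewrite sp mem_head.
by apply; exact: integral_tent_le.
Qed.

Lemma light_ball_Dup : (forall m, light_ball m mu) -> Dup_minus mu = +oo%E.
Proof.
move=> hm; apply/eqP; rewrite -leye_eq; apply: below_le => // n.
apply: le_elimsup0 => dl dl0.
have [m0 mr] := inv_nat_lt dl0; pose m := maxn m0 n.
have mdl := mr m (leq_maxl _ _).
have [s [r [c [[p Kp [sp rm c0 cr]] r0 [_ mus]]]]] := hm m.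
have r20 : 0 < r / 2 by rewrite divr_gt0.
exists (r / 2); first by rewrite r20 (lt_trans rm).
have r01 : 0 < r / 2 < 1 by rewrite r20 (lt_le_trans rm)// inv_le1.
apply: (@le_trans _ _ (ln (2 * c) / ln (r / 2))%:E).
  by rewrite lee_fin; apply: le_trans cr; rewrite ler_nat leq_maxr.
have c20 : 0 < 2 * c by rewrite mulr_gt0.
apply: elog_ratio_ge => //.
apply: ge_ereal_inf; exists (mu (eball p (r / 2))).
  by exists p => //; rewrite suppK.
apply: le_trans (integral_tent_ge cK p muK r20) _.
have -> : 2 * (r / 2) = r by field.
rewrite EFinM lee_pmul2l//; first by apply/ltW/mus; rewrite sp mem_head.
Qed.

Lemma light_net_Dup : (forall m, light_net m mu) ->
  (upper_box_dim_loc_unif K <= Dup_plus mu)%E.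
Proof.
move=> hm; apply: below_le; first exact: upper_box_dim_loc_unif_ge0.
move=> n; apply: le_elimsup0 => dl dl0.
have [m0 mr] := inv_nat_lt dl0; pose m := maxn m0 n.+1.
have mdl := mr m (leq_maxl _ _).
have [s [r [c [[sK rm c0 cr] r0 [_ mus]]]]] := hm m.
have r20 : 0 < r / 2 by rewrite divr_gt0.
have r40 : 0 < r / 4 by rewrite divr_gt0.
exists (r / 4); first by rewrite r40 (lt_trans rm).
have r01 : 0 < r / 4 < 1 by rewrite r40 (lt_le_trans rm)// inv_le1.
apply: (@le_trans _ _ (ln (2 * c) / ln (r / 4))%:E).
  rewrite lee_fin; apply: le_trans cr; apply/ltW/below_incr.
  by rewrite leq_max ltnSn orbT.
have c20 : 0 < 2 * c by rewrite mulr_gt0.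
apply: elog_ratio_ge => //.
apply/ereal_supP => _ [x + <-]; rewrite suppK => /sK/hasP[z zs /= zx].
apply: (@le_trans _ _ (mu (eball z (r / 2)))).
  apply: le_measure; rewrite ?inE; try exact: measurable_eball.
  by apply: eball_sub; lra.
apply: le_trans (integral_tent_ge cK z muK r20) _.
have -> : 2 * (r / 2) = r by field.
rewrite EFinM lee_pmul2l//; exact/ltW/mus.
Qed.

End Consequences.

(** * Perturbations of simple variables *)

Section Approaching.
Context {dW : measure_display} {W : measurableType dW}.
Variable P : probability W R.
Hypothesis divP : divisible P.
Hypothesis infK : infinite_set K.
Local Notation law Y := (distribution P Y : PR).

Lemma approachable_law (U : set PR) :
  (forall X : {mfun W >-> BR}, simple_in K X -> U (law X)) -> approachable K P U.
Proof.
move=> UX X e sX e0; exists X, set0; split=> //; last exact: UX.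
- by rewrite measure0 lee_fin ltW.
- by move=> w _; rewrite edistxx ltW.
Qed.

(** A simple law has an atom, whose mass exceeds a fixed [q > 0], and [ln q / ln r] tends to 0. *)
Lemma heavy_ball_approachable m : approachable K P (heavy_ball m).
Proof.
apply: approachable_law => X [dX KX].
have [w Pw] := discrete_atom P dX.
have [q q0 qP] : exists2 q : R, 0 < q & (q%:E < P (X @^-1` [set X w]))%E.
  by have [q] := ereal_lt_between Pw; rewrite lte_fin; exists q.
have m0 : 0 < inv m by rewrite invr_gt0.
have [dl /andP[dl0 dl1] dlP] := small_ln_bound (- ln q) m0.
pose r := Num.min dl (inv m) / 2.
have r0 : 0 < r by rewrite divr_gt0// lt_min dl0.
have [rdl rm] : r < dl /\ r < inv m.
  have : r < Num.min dl (inv m) by rewrite /r ltr_pdivrMr// ltr_pMr ?ltr1n// lt_min dl0.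
  by rewrite lt_min => /andP[].
have lnr : ln r < 0 by apply: ln_lt0; rewrite r0 (lt_le_trans rdl).
exists [:: X w], r, q; split=> //.
  exists (X w) => //; split=> //; rewrite ler_ndivrMr//.
  by have := dlP r; rewrite r0 mulrN lerN2; exact.
split; first exact: law_PK.
move=> z; rewrite mem_seq1 => /eqP ->; apply: lt_le_trans qP _.
exact: (integral_tent_ge1 cK (law X) (KX w) r0).
Qed.

(** An infinite [K] has a point [p] outside the finite range of [X], and small balls around [p] are
    null. *)
Lemma light_ball_approachable m : approachable K P (light_ball m).
Proof.
apply: approachable_law => X [dX KX].
have [p Kp Xp] : exists2 p, K p & ~ range X p.
  apply: contrapT => np; apply: infK; apply: sub_finite_set dX.1 => x Kx.
  by apply: contrapT => nx; apply: np; exists x.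
have /finite_seqP[s sE] := dX.1.
have [e e0 ep] : exists2 e : R, 0 < e & forall w, e <= edist p (X w).
  have : forall i : 'I_(size s), 0 < edist p (nth 0 s i).
    move=> i; rewrite lt_neqAle edist_ge0 andbT eq_sym; apply/eqP => /edist_eq0 pi.
    have : [set` s] p by rewrite pi /=; exact: mem_nth.
    by rewrite -sE.
  move=> /finite_lower_bound[e e0 eP]; exists e => // w.
  have : range X (X w) by exists w.
  rewrite sE /= => ws; have ws' : (index (X w) s < size s)%N by rewrite index_mem.
  by have := eP (Ordinal ws'); rewrite /= nth_index.
have m0 : 0 < inv m by rewrite invr_gt0.
pose r := Num.min e (inv m).
have r0 : 0 < r by rewrite lt_min e0.
have r20 : 0 < r / 2 by rewrite divr_gt0.
have r2m : r / 2 < inv m.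
  by apply: (@lt_le_trans _ _ r); [lra|rewrite ge_min lexx orbT].
have lnr : ln (r / 2) < 0 by apply: ln_lt0; rewrite r20 (lt_le_trans r2m)// inv_le1.
(* Chosen so that [ln (2 * c) / ln (r / 2)] is exactly [m]. *)
pose c := (r / 2) ^+ m / 2.
have c0 : 0 < c by rewrite divr_gt0// exprn_gt0.
exists [:: p], r, c; split=> //.
  exists p => //; split=> //; rewrite ler_ndivlMr// /c mulrC divfK//.
  by rewrite lnXn// mulr_natl.
split; first exact: law_PK.
move=> z; rewrite mem_seq1 => /eqP ->.
apply: le_lt_trans (integral_tent_le cK p (law_PK P KX) r0) _.
have Xp0 : X @^-1` eball p r = set0.
  apply/seteqP; split=> // w; rewrite /eball/= ltNge => /negP; apply.
  by apply: le_trans (ep w); rewrite ge_min lexx.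
have -> : law X (eball p r) = P set0 by rewrite -Xp0.
by rewrite measure0 lte_fin.
Qed.

(** With probability [1 / (Q + 1) < e], [X] is replaced by a uniform point of a net of
    [n = Ncov K r] points of [K]; each then has mass at least [1 / (n * (Q + 1))]. *)
Lemma heavy_net_approachable m : approachable K P (heavy_net m).
Proof.
move=> X e [dX KX] e0; have [h hE] : exists h : R, h = inv m by exists (inv m).
have h0 : 0 < h by rewrite hE invr_gt0.
have h1 : h <= 1 by rewrite hE inv_le1.
have K0 : K !=set0 by exists (X point); exact: KX.
have t0 := lower_box_dim_ge0 K0; set t := lower_box_dim K in t0 *.
have [Q /(_ Q (leqnn _)) Qe] := inv_nat_lt e0.
have Q0 : 0 < Q.+1%:R :> R by [].
have h20 : 0 < h / 2 by rewrite divr_gt0.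
(* The terms pay for halving [c], for the factor [Q + 1], and for the passage from [r] to [4 * r].
   If [t] is infinite, [fine t] is a default value and the target bound is trivial. *)
have [dl /andP[dl0 dl1] dlP] :=
  small_ln_bound (ln 2 + ln Q.+1%:R + (fine t + h) * ln 4) h20.
have m0 : 0 < Num.min dl (h / 4) by rewrite lt_min dl0 divr_gt0.
have [r /andP[r0 rm] rt] : exists2 r : R, 0 < r < Num.min dl (h / 4) &
    (box_ratio K r <= t + (h / 2)%:E)%E.
  case tE : t t0 => [x| |]// _.
    have [|r rm rt] := @eliminf0_lt _ (box_ratio K) (t + (h / 2)%:E)%E _ _ m0.
      by rewrite -/(lower_box_dim K) -/t tE -EFinD lte_fin ltrDl.
    by exists r => //; rewrite -tE ltW.
  exists (Num.min dl (h / 4) / 2); last by rewrite addye ?leey.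
  by rewrite divr_gt0//= ltr_pdivrMr// ltr_pMr ?ltr1n.
move: rm; rewrite lt_min => /andP[rdl rh].
have r20 : 0 < 2 * r by rewrite mulr_gt0.
have r4E : 2 * (2 * r) = 4 * r by ring.
have lnr : ln r < 0 by apply: ln_lt0; rewrite r0 (lt_le_trans rdl).
have lnr4 : ln (4 * r) < 0 by apply: ln_lt0; rewrite mulr_gt0//=; lra.
have [n [c0 [cov NE]]] := Ncov_attained (compact_finite_cover cK (@subset_refl _ K) r0).
have n1 : (1 <= n)%N by have := Ncov_ge1 r K0; rewrite NE lee_fin ler1n.
have n0 : 0 < n%:R :> R by rewrite ltr0n.
(* Moving the centres into [K] doubles the radius of the net, and [heavy_net] doubles it again. *)
have /choice[y yP] i : exists y, K y /\
    forall x, K x -> eball (c0 i) r x -> edist y x < 2 * r.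
  have [[y [Ky cy]]|ne] := pselect (K `&` eball (c0 i) r !=set0); last first.
    by have [x Kx] := K0; exists x; split=> // z Kz cz; case: ne; exists z.
  exists y; split=> // x Kx cx; have := edist_triangle (c0 i) y x.
  by move: cx cy; rewrite /eball/= (edistC y (c0 i)); lra.
pose s := codom y.
have ss : size s = n by rewrite size_codom card_ord.
(* [b = 0] is the event on which [X] is replaced; [k], independent of [b], selects the net point. *)
have [b [db _ bP]] := fresh_index divP Q (discrete_cst tt).
have [k [dk kn kP]] := fresh_index divP n.-1 db.
have dY : discrete (fun w => if b w == 0%N then nth 0 s (k w) else X w).
  exact: (discrete_comp2 (fun (p : nat * nat) x => if p.1 == 0%N then nth 0 s p.2 else x)
    (discrete_comp2 pair db dk) dX).
have [Y dY' YE] := discrete_mfun dY.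
have KY w : K (Y w).
  rewrite YE; case: ifP => // _.
  have : nth 0 s (k w) \in s by apply: mem_nth; rewrite ss -(prednK n1) ltnS.
  by move=> /codomP[i ->]; exact: (yP i).1.
have Pb : P (b @^-1` [set 0%N]) = (Q.+1%:R^-1)%:E.
  have := bP tt 0%N (leq0n _).
  rewrite (_ : _ @^-1` [set tt] = setT); last first.
    by apply/seteqP; split=> // w _; case: (_ w).
  by rewrite setTI probability_setT mule1.
pose c : R := (n%:R * Q.+1%:R)^-1 / 2.
have cp : 0 < c by rewrite divr_gt0// invr_gt0 mulr_gt0.
exists Y, (b @^-1` [set 0%N]); split=> //.
- exact: db.2.
- by rewrite Pb lee_fin ltW.
- by move=> w /= bw; rewrite YE ifN ?edistxx ?ltW//; apply/eqP.
exists s, (2 * r), c; split=> //.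
  split=> //.
  - move=> x Kx; have [i _ cx] := cov x Kx; apply/hasP; exists (y i).
      exact: codom_f.
    exact: (yP i).2.
  - by rewrite -hE r4E mulrC -ltr_pdivlMr.
  - rewrite -hE r4E; case tE : t t0 rt dlP => [x| |]//= _; last first.
      by move=> *; rewrite -/t tE addye ?leey.
    rewrite /box_ratio NE/= n0 -EFinM -EFinD lee_fin ler_pdivrMr ?oppr_gt0// => rt.
    move=> /(_ r); rewrite r0 rdl => /(_ isT) dlP.
    rewrite -/t tE -EFinD lee_fin ler_ndivrMr// /c ln_div ?posrE ?invr_gt0 ?mulr_gt0//.
    rewrite lnV ?posrE ?mulr_gt0// lnM ?posrE// lnM ?posrE//.
    by move: rt dlP; move: (ln _) (ln n%:R) (ln Q.+1%:R) (ln 4) (ln 2) => *; nra.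
split; first exact: law_PK.
move=> z /codomP[i ->].
apply: lt_le_trans (integral_tent_ge1 cK (law Y) (yP i).1 r20).
have ik : (i <= n.-1)%N by rewrite -ltnS prednK.
apply: (@lt_le_trans _ _ (P (b @^-1` [set 0%N] `&` k @^-1` [set nat_of_ord i]))).
  rewrite kP// Pb prednK// -EFinM lte_fin /c invfM.
  by rewrite ltr_pdivrMr// ltr_pMr ?ltr1n// mulr_gt0 ?invr_gt0.
have mz : measurable (Y @^-1` [set y i]) by exact: dY'.2.
apply: le_measure; rewrite ?inE//.
  by apply: measurableI; [exact: db.2|exact: dk.2].
move=> w [/= bw kw]; rewrite YE bw eqxx kw /s codomE (nth_map i) ?size_enum_ord//.
by rewrite nth_ord_enum.
Qed.

End Approaching.
End Requirements.

(** * Spreading atoms over separated sets *)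

Section LightNet.
Variables (R : realType) (d : nat).
Local Notation BR := (BorelRd R d).
Local Notation PR := (probability BR R).
Variable K : set 'rV[R]_d.
Hypothesis cK : compact K.
Context {dW : measure_display} {W : measurableType dW}.
Variable P : probability W R.
Hypothesis divP : divisible P.
Local Notation inv m := (m.+1%:R^-1 : R).
Local Notation law Y := (distribution P Y : PR).

(** The family [xs] with radius [e] is one of those in the infimum defining the dimension. So at
    arbitrarily small scales [r] the minimum over [i] exceeds [a], which serves all the balls at
    once; [expR (a * - ln r)] is [r] to the power [-a]. *)
Lemma separated_in_balls n (xs : 'I_n -> 'rV[R]_d) (e a dl : R) : (0 < n)%N ->
  (forall i, K (xs i)) -> 0 < e -> (a%:E < upper_box_dim_loc_unif K)%E -> 0 < dl ->
  exists2 r : R, 0 < r < dl & forall i,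
    exists z : nat -> 'rV[R]_d, let k := (Num.truncn (expR (a * - ln r))).+1 in
      (forall j, (j < k)%N -> K (z j) /\ eball (xs i) e (z j)) /\
      forall j j', (j < j' < k)%N -> r <= edist (z j) (z j').
Proof.
move=> n0 Kxs e0 aK dl0.
have m0 : 0 < Num.min 1 dl by rewrite lt_min ltr01.
pose psi r := ereal_inf [set box_ratio (K `&` eball (xs i) e) r | i in [set: 'I_n]].
have apsi : (a%:E < elimsup0 psi)%E.
  apply: lt_le_trans aK _; apply: ge_ereal_inf; exists (elimsup0 psi) => //.
  by exists n, xs, e.
have [r /andP[r0]] := lt_elimsup0 apsi m0; rewrite lt_min => /andP[r1 rdl] ar.
exists r; first by rewrite r0.
move=> i; set M := expR _; set E := K `&` eball (xs i) e.
have E0 : E !=set0 by exists (xs i); split=> //; exact: eball_center.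
have lnr : ln r < 0 by apply: ln_lt0; rewrite r0.
have [k [c [cov NE]]] :=
  Ncov_attained (compact_finite_cover cK (@subIsetl _ K (eball (xs i) e)) r0).
have k1 : (1 <= k)%N by have := Ncov_ge1 r E0; rewrite NE lee_fin ler1n.
have k0 : 0 < k%:R :> R by rewrite ltr0n.
have ak : (a%:E < box_ratio E r)%E.
  by apply: lt_le_trans ar _; apply: ge_ereal_inf; exists (box_ratio E r) => //; exists i.
move: ak; rewrite /box_ratio NE/= k0 -EFinM lte_fin ltr_pdivlMr ?oppr_gt0// => ak.
have Mk : M < k%:R by rewrite -[ltRHS]lnK ?posrE// ltr_expR.
have [|z [Ez zz]] := @separated_exists _ _ E r (Num.truncn M).+1.
  rewrite NE lee_fin ler_nat -(ltr_nat R); apply: le_lt_trans Mk.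
  by rewrite truncn_le// expR_ge0.
by exists z; split=> // j /Ez[].
Qed.

(** Each atom is spread uniformly over [n.+1] points within [e] of it. A ball of radius [4 * r]
    meets at most one of the points coming from a given atom, so its conditional mass is at most
    [1 / (n + 1)]. *)
Lemma light_net_approachable m : approachable K P (light_net K m).
Proof.
move=> X e [dX KX] e0.
have /finite_seqP[xs xsE] := dX.1.
have xsX w : X w \in xs.
  have : range X (X w) by exists w.
  by rewrite xsE.
have xs0 : (0 < size xs)%N by have := xsX point; case: (xs).
have Kxs (i : 'I_(size xs)) : K (nth 0 xs i).
  have : [set` xs] (nth 0 xs i) by exact: mem_nth.
  by rewrite -xsE => -[w _ <-].
set dimK := upper_box_dim_loc_unif K.
have dimK0 : (0 <= dimK)%E by exact: upper_box_dim_loc_unif_ge0.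
have [a aE] : exists a, below dimK m = a by exists (below dimK m).
have := below_incr dimK (ltnSn m); rewrite aE; have := below_lt m.+1 dimK0.
move: (below dimK m.+1) => b bK ab.
(* The gap [b - a] between consecutive approximations of the dimension pays for the factor 2 of
   [light_net] and for separation at [8 * r] instead of [r]. *)
have [dl /andP[dl0 dl1] dlP] :=
  small_ln_bound (ln 2 + b * ln 8) (etrans (subr_gt0 _ _) ab).
have inv0 : 0 < inv m by rewrite invr_gt0.
have m0 : 0 < 8 * Num.min dl (inv m) by rewrite mulr_gt0// lt_min dl0.
have [r8 /andP[r80 r8m] sep] := separated_in_balls xs0 Kxs e0 bK m0.
have [r r8E] : exists r, r8 = 8 * r by exists (r8 / 8); field.
have r0 : 0 < r by move: r80; rewrite r8E pmulr_rgt0.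
move: r8m; rewrite r8E ltr_pM2l// lt_min => /andP[rdl rm].
have lnr : ln r < 0 by apply: ln_lt0; rewrite r0 (lt_le_trans rdl).
set n := Num.truncn (expR (b * - ln (8 * r))) in sep.
rewrite r8E -/n in sep.
have /choice[z zP] x : exists z : nat -> 'rV[R]_d, x \in xs ->
    (forall j, (j <= n)%N -> K (z j) /\ eball x e (z j)) /\
    forall j j', (j < j' <= n)%N -> 8 * r <= edist (z j) (z j').
  have [xxs|nxxs] := boolP (x \in xs); last by exists (fun=> 0).
  have xxs' : (index x xs < size xs)%N by rewrite index_mem.
  have [z] := sep (Ordinal xxs'); rewrite /= nth_index// => -[Kz zz].
  by exists z.
have [h [dh hn hP]] := fresh_index divP n dX.
have dY : discrete (fun w => z (X w) (h w)) by exact: discrete_comp2.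
have [Y dY' YE] := discrete_mfun dY.
have KY w : K (Y w) by rewrite YE; exact: ((zP _ (xsX w)).1 _ (hn w)).1.
have [cs [_ csK]] := compact_eball_cover cK r0.
have r40 : 0 < 4 * r by rewrite mulr_gt0.
have r4E : 4 * r / 4 = r by field.
set M := expR (b * - ln (8 * r)).
have M0 : 0 < M by exact: expR_gt0.
exists Y, set0; split=> //.
- by rewrite measure0 lee_fin ltW.
- by move=> w _; rewrite YE; apply: ltW; exact: ((zP _ (xsX w)).1 _ (hn w)).2.
exists cs, (4 * r), M^-1; split=> //.
  split; rewrite ?r4E// ?invr_gt0// -/dimK aE ler_ndivlMr//.
  rewrite lnM ?posrE ?invr_gt0// lnV ?posrE// expRK lnM ?posrE//.
  by have := dlP r; rewrite r0 rdl => /(_ isT); lra.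
split; first exact: law_PK.
move=> q _; apply: le_lt_trans (integral_tent_le cK q (law_PK P KY) r40) _.
apply: (@le_lt_trans _ _ (n.+1%:R^-1)%:E); last first.
  by rewrite lte_fin ltf_pV2 ?posrE//; exact: truncnS_gt.
have mA : measurable (Y @^-1` eball q (4 * r)) by exact: dY'.2.
suff : (P (Y @^-1` eball q (4 * r)) <= (n.+1%:R^-1)%:E)%E by [].
have inv_n0 : 0 <= n.+1%:R^-1 :> R by rewrite invr_ge0.
apply: (measure_discrete_le (T := 'rV[R]_d) (X := X) dX mA inv_n0) => x.
have [[w0 [/= Xw0 Yw0]]|ne] :=
  pselect (X @^-1` [set x] `&` Y @^-1` eball q (4 * r) !=set0); last first.
  rewrite (_ : _ `&` _ = set0) ?measure0 ?mule_ge0//.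
  by apply/seteqP; split=> // w Hw; apply: ne; exists w.
rewrite -(hP x (h w0)) ?hn//; apply: le_measure; rewrite ?inE.
- by apply: measurableI => //; exact: dX.2.
- by apply: measurableI; [exact: dX.2|exact: dh.2].
move=> w [/= Xw Yw]; split=> //=.
have xxs : x \in xs by rewrite -Xw.
(* Two points of an open ball of radius [4 * r] are less than [8 * r] apart. *)
have disj j j' : (j < j' <= n)%N -> eball q (4 * r) (z x j) ->
    eball q (4 * r) (z x j') -> False.
  move=> /((zP x xxs).2 _ _) zz; rewrite /eball/= => qj qj'.
  by have := edist_triangle q (z x j) (z x j'); rewrite (edistC _ q); lra.
move: Yw Yw0; rewrite /= !YE Xw Xw0 => Yw Yw0.
apply/eqP/contraT; rewrite neq_ltn => /orP[hh|hh].
- by exfalso; apply: (disj _ _ _ Yw Yw0); rewrite hh hn.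
- by exfalso; apply: (disj _ _ _ Yw0 Yw); rewrite hh hn.
Qed.

End LightNet.

Theorem theorem7p1 (R : realType) (d : nat) (K : set 'rV[R]_d) :
  compact K -> infinite_set K ->
  typical K (fun mu => [/\ Dlow_plus mu = 0%E,
                           Dup_plus mu = upper_box_dim_loc_unif K,
                           Dlow_minus mu = lower_box_dim K
                         & Dup_minus mu = +oo%E]).
Proof.
move=> cK infK; have divP := @uniform01_divisible R.
(* The residue modulo 4 merges the four countable families into one sequence. *)
pose U n : set (probability (BorelRd R d) R) := match (n %% 4)%N with
  | 0%N => heavy_ball K (n %/ 4)
  | 1%N => heavy_net K (n %/ 4)
  | 2%N => light_ball K (n %/ 4)
  | _ => light_net K (n %/ 4)
  end.
have oU n : weak_open K (U n).
  rewrite /U; case: (n %% 4)%N => [|[|[|k]]]; try exact: weak_open_tents_gt;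
    exact: weak_open_tents_lt.
exists U; split=> //.
  apply: (approachable_dense cK divP) => // n; rewrite /U.
  case: (n %% 4)%N => [|[|[|k]]].
  - exact: heavy_ball_approachable.
  - exact: heavy_net_approachable.
  - exact: light_ball_approachable.
  - exact: light_net_approachable.
move=> mu muU; have muK : PK K mu := (oU 0%N).1 _ (muU 0%N I).
have hb m : heavy_ball K m mu by have := muU (m * 4)%N I; rewrite /U modnMl mulnK.
have hn m : heavy_net K m mu.
  by have := muU (m * 4 + 1)%N I; rewrite /U modnMDl divnMDl// addn0.
have lb m : light_ball K m mu.
  by have := muU (m * 4 + 2)%N I; rewrite /U modnMDl divnMDl// addn0.
have ln m : light_net K m mu.
  by have := muU (m * 4 + 3)%N I; rewrite /U modnMDl divnMDl// addn0.
have suppK : supp mu = K by exact: heavy_net_supp.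
split.
- apply/eqP; rewrite eq_le Dlow_plus_ge0 andbT.
  exact: (heavy_ball_Dlow cK muK suppK hb).
- apply/eqP; rewrite eq_le (light_net_Dup cK muK suppK ln) andbT.
  exact: Dup_le_upper_box_dim.
- apply/eqP; rewrite eq_le (heavy_net_Dlow cK muK suppK hn)/=.
  exact: lower_box_dim_le_Dlow.
- exact: (light_ball_Dup cK muK suppK lb).
Qed.
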